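(* Let $\pi:M\to B$ be a Riemannian submersion from a complete connected Riemannian manifold $M$ with nonnegative sectional curvature onto a connected Riemannian manifold $B$. Let $b_0\in B$ be a base point, let $F=\pi^{-1}(b_0)$, and let $\partial:\pi_q(B)\to\pi_{q-1}(F)$ denote the boundary operator in the long exact homotopy sequence of the fibration $F\to M\to B$. If $\pi$ is not twisted, then for any $q\ge 1$ and any $[a]\in\pi_q(B)$, the homotopy class $\partial[a]$ can be represented by a map $f:S^{q-1}\to F$ that is not surjective.
   Context: A horizontal curve of a Riemannian submersion $\pi:M\to B$ is a (piecewise smooth) curve in $M$ that is orthogonal to the fibers of $\pi$ at every point. The dual leaf through $p\in M$ is the set of all points of $M$ that can be reached from $p$ by horizontal curves; the collection of dual leaves is the dual foliation. The submersion $\pi$ is called twisted if the dual foliation consists of a single leaf, i.e. any two points of $M$ can be joined by a horizontal curve. Since $M$ is complete, $\pi$ is a locally trivial fiber bundle, so the long exact homotopy sequence is available: $\cdots\to\pi_q(F)\to\pi_q(M)\to\pi_q(B)\xrightarrow{\partial}\pi_{q-1}(F)\to\cdots$ (base points: $b_0\in B$ and a point of $F$). *)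

(* Defs.v *)
From HB Require Import structures.
From mathcomp Require Import all_boot all_order all_algebra.
From mathcomp Require Import all_classical all_reals all_analysis.

Set Implicit Arguments.
Unset Strict Implicit.
Unset Printing Implicit Defensive.

Import Order.TTheory GRing.Theory Num.Theory.
Import numFieldNormedType.Exports.

Local Open Scope classical_set_scope.
Local Open Scope ring_scope.

(* Smoothness on a subset U of a finite-dimensional space V.  U is always open
   below; continuity of all iterated directional derivatives is then the usual
   C^k condition. *)
Section Smooth.
Context {R : realType} {V W : normedModType R}.

Fixpoint Ck_on (k : nat) (U : set V) (f : V -> W) : Prop :=
  (forall x, U x -> {for x, continuous f}) /\
  match k with
  | 0 => True
  | k'.+1 => forall v : V, (forall x, U x -> derivable f x v) /\
                           Ck_on k' U ('D_v f)
  end.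

Definition smooth_on (U : set V) (f : V -> W) : Prop := forall k, Ck_on k U f.

End Smooth.

(* Only the values of to_coord on chart_dom and of of_coord on chart_cod are
   meaningful. *)
Record chart (R : realType) (n : nat) (X : topologicalType) := Chart {
  chart_dom : set X;
  chart_cod : set 'rV[R]_n;
  to_coord : X -> 'rV[R]_n;
  of_coord : 'rV[R]_n -> X;
  chart_dom_open : open chart_dom;
  chart_cod_open : open chart_cod;
  to_coord_cod : forall x, chart_dom x -> chart_cod (to_coord x);
  of_coord_dom : forall y, chart_cod y -> chart_dom (of_coord y);
  to_coordK : forall x, chart_dom x -> of_coord (to_coord x) = x;
  of_coordK : forall y, chart_cod y -> to_coord (of_coord y) = y;
  to_coord_cts : forall x, chart_dom x -> {for x, continuous to_coord};
  of_coord_cts : forall y, chart_cod y -> {for y, continuous of_coord} }.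

Section Charts.
Context {R : realType} {n : nat} {X : topologicalType}.

Definition transition (c d : chart R n X) (y : 'rV[R]_n) : 'rV[R]_n :=
  to_coord d (of_coord c y).

Definition overlap (c d : chart R n X) : set 'rV[R]_n :=
  [set y | chart_cod c y /\ chart_dom d (of_coord c y)].

End Charts.

Definition gform (R : realType) (n : nat) (G : 'M[R]_n) (u v : 'rV[R]_n) : R :=
  (u *m G *m v^T) 0 0.

(* A smooth n-manifold given by an atlas, with a Riemannian metric.  chart_at
   selects a chart around each point; the tangent space at x is identified with
   'rV[R]_n through the coordinates of chart_at x.  metric c y is the Gram
   matrix of the coordinate frame of the chart c at the point of coordinates y. *)
Record riemannianManifold (R : realType) (n : nat) := RiemannianManifold {
  carrier :> topologicalType;
  carrier_hausdorff : hausdorff_space carrier;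
  carrier_second_countable : @second_countable carrier;
  atlas : set (chart R n carrier);
  chart_at : carrier -> chart R n carrier;
  chart_at_atlas : forall x, atlas (chart_at x);
  chart_at_dom : forall x, chart_dom (chart_at x) x;
  atlas_smooth : forall c d, atlas c -> atlas d ->
    smooth_on (overlap c d) (transition c d);
  metric : chart R n carrier -> 'rV[R]_n -> 'M[R]_n;
  metric_smooth : forall c, atlas c -> smooth_on (chart_cod c) (metric c);
  metric_sym : forall c, atlas c -> forall y, chart_cod c y ->
    (metric c y)^T = metric c y;
  metric_pos : forall c, atlas c -> forall y, chart_cod c y ->
    forall u, u != 0 -> 0 < gform (metric c y) u u;
  metric_compat : forall c d, atlas c -> atlas d ->
    forall y, overlap c d y -> forall u v,
    gform (metric c y) u v =
    gform (metric d (transition c d y))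
      ('D_u (transition c d) y) ('D_v (transition c d) y) }.

Section TangentSpaces.
Context {R : realType}.

Definition coord_at {n} {M : riemannianManifold R n} (x : M) : 'rV[R]_n :=
  to_coord (chart_at x) x.

Definition inner {n} {M : riemannianManifold R n} (x : M) (u v : 'rV[R]_n) : R :=
  gform (metric (chart_at x) (coord_at x)) u v.

Definition smooth_map {n m} {M : riemannianManifold R n}
    {N : riemannianManifold R m} (f : M -> N) : Prop :=
  continuous f /\
  forall c d, atlas c -> atlas d ->
    smooth_on [set y | chart_cod c y /\ chart_dom d (f (of_coord c y))]
      (fun y => to_coord d (f (of_coord c y))).

Definition differential {n m} {M : riemannianManifold R n}
    {N : riemannianManifold R m} (f : M -> N) (x : M) (v : 'rV[R]_n) :
    'rV[R]_m :=
  'D_v (fun y => to_coord (chart_at (f x)) (f (of_coord (chart_at x) y)))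
    (coord_at x).

End TangentSpaces.

Section Curvature.
Context {R : realType} {n : nat} {M : riemannianManifold R n}.
Implicit Types (c : chart R n M) (y u v w : 'rV[R]_n).

Definition partial (i : 'I_n) (f : 'rV[R]_n -> R) : 'rV[R]_n -> R :=
  'D_(delta_mx 0 i) f.

Definition christoffel c (l i j : 'I_n) y : R :=
  2^-1 * \sum_(k < n) invmx (metric c y) l k *
    (partial i (fun z => metric c z j k) y +
     partial j (fun z => metric c z i k) y -
     partial k (fun z => metric c z i j) y).

(* the l-th component of R(e_i, e_j) e_k, for the sign convention
   R(X,Y)Z = nabla_X nabla_Y Z - nabla_Y nabla_X Z - nabla_[X,Y] Z *)
Definition riemann_coef c (i j k l : 'I_n) y : R :=
  partial i (christoffel c l j k) y - partial j (christoffel c l i k) y +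
  \sum_(h < n) (christoffel c h j k y * christoffel c l i h y -
                christoffel c h i k y * christoffel c l j h y).

Definition riemann (x : M) u v w : 'rV[R]_n :=
  \row_l \sum_(i < n) \sum_(j < n) \sum_(k < n)
    u 0 i * v 0 j * w 0 k * riemann_coef (chart_at x) i j k l (coord_at x).

Definition sectional_curvature (x : M) u v : R :=
  inner x (riemann x u v v) u /
  (inner x u u * inner x v v - inner x u v ^+ 2).

End Curvature.

Definition nonneg_sectional_curvature {R : realType} {n : nat}
    (M : riemannianManifold R n) : Prop :=
  forall (x : M) (u v : 'rV[R]_n), row_free (col_mx u v) ->
    0 <= sectional_curvature x u v.

Section Curves.
Context {R : realType} {n : nat} {M : riemannianManifold R n}.

Definition smooth_curve (O : set R) (gamma : R -> M) : Prop :=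
  (forall t, O t -> {for t, continuous gamma}) /\
  forall c, atlas c ->
    smooth_on [set t : R | O t /\ chart_dom c (gamma t)]
      (fun t : R => to_coord c (gamma t)).

(* s lists the right end points of the pieces, so that consecutive entries of
   a :: s delimit them; each piece is the restriction to a closed interval of a
   curve which is smooth on a neighbourhood of that interval. *)
Definition piecewise_smooth_along (a b : R) (s : seq R) (gamma : R -> M) :
    Prop :=
  itv_partition a b s /\
  forall i, (i < size s)%N ->
    let J := `[nth b (a :: s) i, nth b s i]%classic in
    exists (O : set R) (delta : R -> M),
      [/\ open O, J `<=` O, smooth_curve O delta &
          forall t, J t -> delta t = gamma t].

Definition piecewise_smooth (a b : R) (gamma : R -> M) : Prop :=
  exists s, piecewise_smooth_along a b s gamma.

Definition velocity (gamma : R -> M) (t : R) : 'rV[R]_n :=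
  'D_1 (fun r : R => to_coord (chart_at (gamma t)) (gamma r)) t.

(* The velocity is meaningless at the finitely many break points, which do not
   contribute to the integral. *)
Definition curve_length (a b : R) (gamma : R -> M) : \bar R :=
  (\int[lebesgue_measure]_(t in `[a, b])
     (Num.sqrt (inner (gamma t) (velocity gamma t) (velocity gamma t)))%:E)%E.

Definition riemannian_dist (x y : M) : \bar R :=
  ereal_inf [set l | exists (a b : R) (gamma : R -> M),
    [/\ piecewise_smooth a b gamma, gamma a = x, gamma b = y &
        l = curve_length a b gamma]].

End Curves.

Definition complete_manifold {R : realType} {n : nat}
    (M : riemannianManifold R n) : Prop :=
  forall u : nat -> M,
    (forall e : R, 0 < e -> exists N : nat, forall i j : nat,
       (N <= i)%N -> (N <= j)%N -> (riemannian_dist (u i) (u j) < e%:E)%E) ->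
    exists x : M, u @ \oo --> x.

Section Submersions.
Context {R : realType} {n m : nat}.
Context {M : riemannianManifold R n} {B : riemannianManifold R m}.
Context (p : M -> B).

(* orthogonality to the kernel of the differential at x, which is the tangent
   space of the fiber of p through x *)
Definition horizontal (x : M) (u : 'rV[R]_n) : Prop :=
  forall w, differential p x w = 0 -> inner x u w = 0.

Definition riemannian_submersion : Prop :=
  [/\ smooth_map p,
      forall b, exists x, p x = b,
      forall x v, exists u, differential p x u = v &
      forall x u v, horizontal x u -> horizontal x v ->
        inner (p x) (differential p x u) (differential p x v) = inner x u v].

(* At a break point the one-sided velocities are horizontal by continuity. *)
Definition horizontal_curve (a b : R) (gamma : R -> M) : Prop :=
  exists2 s : seq R, piecewise_smooth_along a b s gamma &
    forall t, a < t < b -> t \notin s -> horizontal (gamma t) (velocity gamma t).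

Definition dual_leaf (x : M) : set M :=
  [set y | exists (a b : R) (gamma : R -> M),
     [/\ horizontal_curve a b gamma, gamma a = x & gamma b = y]].

Definition twisted : Prop := forall x : M, dual_leaf x = setT.

End Submersions.

(* Homotopy groups.  Elements of pi_q(X, A, x0) are classes of maps of triples
   (D^q, S^(q-1), s0) -> (X, A, x0), those of pi_q(X, x0) are the classes for
   A = {x0}, and those of pi_(q-1)(A, x0) are classes of based maps
   (S^(q-1), s0) -> (A, x0); here q >= 1.  Maps out of D^q or S^(q-1) are
   functions on 'rV[R]_q of which only the values on D^q or S^(q-1) matter, and
   a class is the set of its representatives. *)
Section Homotopy.
Context {R : realType} (q : nat).
Local Notation V := 'rV[R]_q.

Definition disc : set V := [set x | \sum_(i < q) x 0 i ^+ 2 <= 1].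

Definition sphere : set V := [set x | \sum_(i < q) x 0 i ^+ 2 = 1].

Definition base_point : V := \row_(i < q) (i == 0%N :> nat)%:R.

Context {X : topologicalType}.

Definition disc_map (A : set X) (x0 : X) (f : V -> X) : Prop :=
  [/\ {within disc, continuous f}, forall x, sphere x -> A (f x) &
      f base_point = x0].

Definition sphere_map (A : set X) (x0 : X) (f : V -> X) : Prop :=
  [/\ {within sphere, continuous f}, forall x, sphere x -> A (f x) &
      f base_point = x0].

Definition homotopic (K : set V) (P : (V -> X) -> Prop) (f g : V -> X) : Prop :=
  exists H : R * V -> X,
    [/\ {within `[0, 1]%classic `*` K, continuous H},
        forall x, K x -> H (0, x) = f x,
        forall x, K x -> H (1, x) = g x &
        forall t, 0 <= t <= 1 -> P (fun x => H (t, x))].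

Definition homotopy_class (x0 : X) (a : V -> X) : set (V -> X) :=
  [set g | homotopic disc (disc_map [set x0] x0) a g].

Definition homotopy_group (x0 : X) : set (set (V -> X)) :=
  [set homotopy_class x0 a | a in disc_map [set x0] x0].

End Homotopy.

(* The connecting operator pi_q(B, p x0) -> pi_(q-1)(F, x0), F the fiber through
   x0: the inverse of p_* : pi_q(M, F, x0) -> pi_q(B, p x0) followed by
   restriction to S^(q-1).  The class is the set of its representatives. *)
Definition boundary {R : realType} {q : nat} {M B : topologicalType}
    (p : M -> B) (x0 : M) (alpha : set ('rV[R]_q -> B)) : set ('rV[R]_q -> M) :=
  let F := p @^-1` [set p x0] in
  [set f | exists h : 'rV[R]_q -> M,
     [/\ disc_map F x0 h, alpha (p \o h) &
         homotopic (@sphere R q) (sphere_map F x0) h f]].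

(* Main.v *)
Require Import Defs.
From mathcomp Require Import all_boot all_order all_algebra.
From mathcomp Require Import all_classical all_reals all_analysis.
From mathcomp Require Import ring lra.
Import Order.TTheory GRing.Theory Num.Theory.
Import numFieldNormedType.Exports.
Set Implicit Arguments.
Unset Strict Implicit.
Unset Printing Implicit Defensive.
Local Open Scope classical_set_scope.
Local Open Scope ring_scope.

(* Lift the paths [t |-> a (e + t (y - e))], where [a : D^q -> B] represents the
   class and [e] is the base point of the sphere, starting from [x0] and inside
   the dual leaf of [x0]. Their end points form a map [h : D^q -> M] with
   [p \o h = a], so the restriction of [h] to the sphere represents the boundary.
   If it were onto the fiber, the fiber would lie in a single dual leaf; since [B]
   is connected, every dual leaf meets the fiber, so there would be only one.

   As [a] is merely continuous, these paths are cut into short pieces, each in a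
   ball of a chart of [B], and a piece is replaced by the horizontal lift of the
   coordinate segment with the same end points. In the charts of [M] this lift
   solves an ordinary differential equation; it exists up to time 1 because its
   speed is bounded and [M] is complete, and its end point depends continuously
   on the data. The charts of [B] that are needed depend on [y]: the end points
   are glued by letting only the paths of a small ball of the disc move at each
   step. *)

(** * Calculus in coordinates *)

(** The homotopy lifting property of the bundle would also give a map over [a], but it says nothing
    about dual leaves: the lift itself has to be made of horizontal pieces. Replacing a continuous
    path by chart segments depends on choices of charts and of a subdivision, and the difficulty is
    to make the outcome continuous in [y]. A clock plays the part of a partition of unity: each path
    has its own time [tau], up to which it has been lifted, and only paths near one point of the
    disc advance theirs at a given step. Gluing is automatic because the horizontal lift of a
    constant segment is constant, so the end point map moves nothing where the clock stands still.
    The same fact keeps the constant path at [e] above [x0], which makes [h] a based map.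

    The bound on the speed comes from the base: a Riemannian submersion is isometric on horizontal
    vectors, so a lift is as fast as its projection, a coordinate segment known in advance.
    Completeness then supplies the limit point from which the lift is continued. *)

Lemma mx_entry_le (R : realType) (m n : nat) (A : 'M[R]_(m, n)) i j :
  `|A i j| <= `|A|.
Proof.
rewrite [X in _ <= X]/Num.norm /= mx_normrE.
by rewrite (bigmax_sup (i, j)).
Qed.

Lemma mx_norm_le (R : realType) (m n : nat) (A : 'M[R]_(m, n)) (K : R) :
  0 <= K -> (forall i j, `|A i j| <= K) -> `|A| <= K.
Proof.
move=> K0 h; rewrite [X in X <= _]/Num.norm /= mx_normrE.
by apply: bigmax_le.
Qed.

Lemma mulmx_norm_le (R : realType) (m n p : nat) (A : 'M[R]_(m, n))
    (B : 'M[R]_(n, p)) : `|A *m B| <= n%:R * `|A| * `|B|.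
Proof.
apply: mx_norm_le; first by rewrite !mulr_ge0.
move=> i j; rewrite mxE (le_trans (ler_norm_sum _ _ _))//.
have -> : n%:R * `|A| * `|B| = \sum_(k < n) `|A| * `|B|.
  by rewrite sumr_const card_ord -mulrA mulr_natl.
apply: ler_sum => k _; rewrite normrM.
by apply: ler_pM => //; exact: mx_entry_le.
Qed.

Lemma derive_dist_le (R : realType) (y y' : R -> R) (a b K : R) :
  (forall t, a < t < b -> is_derive t 1 y (y' t)) ->
  (forall t, a < t < b -> `|y' t| <= K) ->
  forall s t, a < s < b -> a < t < b -> `|y t - y s| <= K * `|t - s|.
Proof.
move=> yd yK s t; wlog st : s t / s < t.
  move=> H hs ht; have [st|ts|->] := ltgtP s t; first exact: H.
    by rewrite distrC [X in _ * X]distrC; exact: H.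
  by rewrite !subrr !normr0 mulr0.
move=> /andP[as_ sb] /andP[at_ tb].
have [||c cst ->] := @MVT R y y' s t st.
- move=> x; rewrite in_itv/= => /andP[sx xt]; apply: yd.
  by rewrite (lt_trans as_ sx) (lt_trans xt tb).
- apply: continuous_in_subspaceT => x; rewrite inE/= in_itv/= => /andP[sx xt].
  apply: differentiable_continuous; apply/derivable1_diffP.
  by have [] := yd x _; first by rewrite (lt_le_trans as_ sx) (le_lt_trans xt tb).
- rewrite normrM; apply: ler_wpM2r => //; apply: yK.
  move: cst; rewrite in_itv/= => /andP[sc ct].
  by rewrite (lt_trans as_ sc) (lt_trans ct tb).
Qed.

Lemma is_derive_mx (R : realType) (V : normedModType R) (m n : nat)
    (y : V -> 'M[R]_(m, n)) (t v : V) (y' : 'M[R]_(m, n)) :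
  is_derive t v y y' <-> forall i j, is_derive t v (fun s => y s i j) (y' i j).
Proof.
split=> [[dy ey] i j|h].
  have dyi : derivable (fun s => y s i j) t v by move/derivable_mxP : dy.
  by apply: DeriveDef => //; rewrite -ey derive_mx// mxE.
have dy : derivable y t v by apply/derivable_mxP => i j; have [] := h i j.
apply: DeriveDef => //; rewrite derive_mx//; apply/matrixP => i j; rewrite mxE.
by have [_ ->] := h i j.
Qed.

Lemma derive_norm_le (R : realType) (m n : nat) (y y' : R -> 'M[R]_(m, n))
    (a b K : R) :
  (forall t, a < t < b -> is_derive t 1 y (y' t)) ->
  (forall t, a < t < b -> `|y' t| <= K) ->
  forall s t, a < s < b -> a < t < b -> `|y t - y s| <= K * `|t - s|.
Proof.
move=> yd yK s t hs ht; apply: mx_norm_le.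
  by rewrite mulr_ge0// (le_trans _ (yK s hs)).
move=> i j; rewrite !mxE.
apply: (@derive_dist_le R (fun u => y u i j) (fun u => y' u i j) a b) => // u hu.
  by have /is_derive_mx := yd u hu.
by apply: le_trans (yK u hu); exact: mx_entry_le.
Qed.

Lemma is_derive_line (R : realType) (V W : normedModType R) (f : V -> W) (x u : V)
    (s : R) : derivable f (x + s *: u) u ->
  is_derive s 1 (fun t : R => f (x + t *: u)) ('D_u f (x + s *: u)).
Proof.
move=> fd.
have E : (fun h : R => h^-1 *: (((fun t : R => f (x + t *: u)) \o shift s) (h *: 1)
     - f (x + s *: u))) =
  (fun h : R => h^-1 *: ((f \o shift (x + s *: u)) (h *: u) - f (x + s *: u))).
  apply/funext => h /=; congr (_ *: (f _ - _)).
  by rewrite [h *: 1]mulr1 scalerDl addrCA addrC -addrA addrC.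
by apply: DeriveDef; rewrite /derivable /derive E.
Qed.

Lemma near_distP (R : realType) (V : normedModType R) (x : V) (P : V -> Prop) :
  (\forall y \near x, P y) <-> exists2 d : R, 0 < d & forall y, `|x - y| < d -> P y.
Proof.
split=> [/nbhs_normP[d /= d0 h]|[d d0 h]]; first by exists d.
by apply/nbhs_normP; exists d.
Qed.

Lemma mx_norm_lt (R : realType) (m n : nat) (A : 'M[R]_(m, n)) (K : R) :
  0 < K -> (forall i j, `|A i j| < K) -> `|A| < K.
Proof.
move=> K0 h; rewrite [X in X < _]/Num.norm /= mx_normrE.
by apply: bigmax_lt => // -[i j].
Qed.

Lemma cvg_mx (R : realType) (T : Type) (F : set_system T) (FF : Filter F)
    (m n : nat) (f : T -> 'M[R]_(m, n)) (l : 'M[R]_(m, n)) :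
  (forall i j, f x i j @[x --> F] --> l i j) -> f @ F --> l.
Proof.
move=> h; apply/cvgrPdist_lt => e e0.
have : \forall x \near F, forall i j, `|l i j - f x i j| < e.
  apply: filter_forall => i; apply: filter_forall => j.
  by move/cvgrPdist_lt : (h i j); apply.
apply: filterS => x hx; apply: mx_norm_lt => // i j.
by rewrite !mxE.
Qed.

Lemma cvg_mx_entry (R : realType) (T : Type) (F : set_system T) (FF : Filter F)
    (m n : nat) (f : T -> 'M[R]_(m, n)) (l : 'M[R]_(m, n)) i j :
  f @ F --> l -> f x i j @[x --> F] --> l i j.
Proof.
move=> h; apply: (cvg_comp _ (fun A : 'M[R]_(m, n) => A i j) h).
exact: coord_continuous.
Qed.

(** Go from [x] to [x + u] along the edges of a box, one coordinate at a time, and apply the mean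
    value inequality on each edge. *)
Lemma C1_expansion (R : realType) (n : nat) (f : 'rV[R]_n -> R) (x : 'rV[R]_n) :
  (forall i : 'I_n, \forall y \near x, derivable f y (delta_mx 0 i)) ->
  (forall i : 'I_n, {for x, continuous ('D_(delta_mx 0 i) f)}) ->
  forall e, 0 < e -> \forall u \near (0 : 'rV[R]_n),
   `|f (x + u) - f x - \sum_(i < n) u 0 i * 'D_(delta_mx 0 i) f x| <= e * `|u|.
Proof.
move=> fd fc e e0.
(* The error is shared among the [n] edges; [n.+1] also covers [n = 0]. *)
pose e' := e / n.+1%:R.
have e'0 : 0 < e' by rewrite divr_gt0.
have h1 : \forall y \near x, forall i : 'I_n, derivable f y (delta_mx 0 i).
  exact: (@filter_forall _ 'I_n (fun i y => derivable f y (delta_mx 0 i)) (nbhs x)).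
have h2 : \forall y \near x, forall i : 'I_n,
    `|'D_(delta_mx 0 i) f x - 'D_(delta_mx 0 i) f y| <= e'.
  apply: (@filter_forall _ 'I_n (fun i y => _ <= e') (nbhs x)) => i.
  by move/cvgrPdist_le : (fc i); apply.
have [d d0 hd] := (near_distP _ _).1 (filterI h1 h2).
apply/nbhs_norm0P; exists d => //= u ud.
(* The [k]-th corner of the path: the first [k] coordinates have already moved. *)
pose w k : 'rV[R]_n := \row_i (if (i < k)%N then u 0 i else 0).
have w0 : w 0%N = 0 by apply/rowP => i; rewrite !mxE.
have wn : w n = u by apply/rowP => i; rewrite !mxE ltn_ord.
have wS (k : 'I_n) : w k.+1 = w k + u 0 k *: delta_mx 0 k.
  apply/rowP => i; rewrite !mxE eqxx/= ltnS leq_eqVlt.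
  case: (eqVneq i k) => [->|ik]; first by rewrite eqxx ltnn mulr1 add0r.
  have -> : (i == k :> nat) = false by apply/negbTE.
  by rewrite mulr0 addr0.
have -> : f (x + u) - f x = \sum_(k < n) (f (x + w k.+1) - f (x + w k)).
  rewrite -(big_mkord xpredT (fun k => f (x + w k.+1) - f (x + w k))).
  by rewrite telescope_sumr// wn w0 addr0.
rewrite -sumrB (le_trans (ler_norm_sum _ _ _))//.
have -> : e * `|u| = n.+1%:R * (e' * `|u|).
  by rewrite /e' mulrA; congr (_ * _); rewrite mulrCA divff ?mulr1.
apply: (@le_trans _ _ (\sum_(k < n) e' * `|u|)); last first.
  rewrite sumr_const card_ord -[X in X <= _]mulr_natl ler_wpM2r//.
    by rewrite mulr_ge0// ltW.
  by rewrite ler_nat.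
apply: ler_sum => k _; rewrite wS.
have uk i : `|u 0 i| < d by apply: le_lt_trans ud; exact: mx_entry_le.
pose y s := f (x + w k + s *: delta_mx 0 k) - s * 'D_(delta_mx 0 k) f x.
have nrm s : - d < s < d -> `|w k + s *: delta_mx 0 k| < d.
  move=> sd; apply: mx_norm_lt => // i j.
  rewrite (ord1 i) !mxE eqxx/=; case: (eqVneq j k) => [->|jk].
    by rewrite ltnn add0r mulr1 ltr_norml.
  by rewrite mulr0 addr0; case: ifP => // _; rewrite normr0.
have hds s : - d < s < d ->
   (forall i, derivable f (x + w k + s *: delta_mx 0 k) (delta_mx 0 i)) /\
   forall i, `|'D_(delta_mx 0 i) f x -
               'D_(delta_mx 0 i) f (x + w k + s *: delta_mx 0 k)| <= e'.
  move=> sd; apply: hd; rewrite -addrA opprD addNKr normrN.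
  exact: nrm.
have -> : f (x + (w k + u 0 k *: delta_mx 0 k)) - f (x + w k) -
   u 0 k * 'D_(delta_mx 0 k) f x = y (u 0 k) - y 0.
  by rewrite /y scale0r !addr0 mul0r subr0 -(addrA x); ring.
apply: (@le_trans _ _ (e' * `|u 0 k - 0|)); last first.
  by rewrite subr0; apply: ler_wpM2l; [exact: ltW|exact: mx_entry_le].
apply: (@derive_dist_le _ y (fun s => 'D_(delta_mx 0 k) f (x + w k + s *: delta_mx 0 k) -
  'D_(delta_mx 0 k) f x) (- d) d e' _ _ 0 (u 0 k)).
- move=> t td; rewrite /y; apply: is_deriveB.
    by apply: is_derive_line; have [] := hds t td.
  rewrite (_ : (fun s : R => s * _) = 'D_(delta_mx 0 k) f x *: (@id R)).
    by apply: is_derive_eq; rewrite [_ *: _]mulr1.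
  by apply/funext => s /=; rewrite mulrC.
- by move=> t td; rewrite distrC; have [_] := hds t td.
- by rewrite oppr_lt0 d0.
- by rewrite -ltr_norml.
Qed.

Lemma cvg_bigsum (R : realType) (V : normedModType R) (T I : Type)
    (F : set_system T) (FF : Filter F) (r : seq I) (f : I -> T -> V) (l : I -> V) :
  (forall i, f i @ F --> l i) ->
  \sum_(i <- r) f i x @[x --> F] --> \sum_(i <- r) l i.
Proof.
move=> h; elim: r => [|i r IH].
  by under eq_fun do rewrite big_nil; rewrite big_nil; exact: cvg_cst.
by under eq_fun do rewrite big_cons; rewrite big_cons; exact: cvgD.
Qed.

Lemma Ck_on_C1 (R : realType) (n : nat) (U : set 'rV[R]_n) (f : 'rV[R]_n -> R) x :
  open U -> Ck_on 1 U f -> U x ->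
  (forall i : 'I_n, \forall y \near x, derivable f y (delta_mx 0 i)) /\
  (forall i : 'I_n, {for x, continuous ('D_(delta_mx 0 i) f)}).
Proof.
move=> oU [_ fd] Ux; split=> i; have [di [ci _]] := fd (delta_mx 0 i); last exact: ci.
have : nbhs x U by exact: open_nbhs_nbhs.
by apply: filterS => y /di.
Qed.

(** [Ck_on] controls derivatives in fixed directions only, whereas the difference quotients of [y]
    have varying directions; [C1_expansion] supplies the uniformity. *)
Lemma is_derive_comp_C1 (R : realType) (V : normedModType R) (n : nat)
    (U : set 'rV[R]_n) (f : 'rV[R]_n -> R) (y : V -> 'rV[R]_n) (y' : 'rV[R]_n) (z v : V) :
  open U -> Ck_on 1 U f -> U (y z) -> is_derive z v y y' ->
  is_derive z v (fun t => f (y t)) (\sum_(i < n) y' 0 i * 'D_(delta_mx 0 i) f (y z)).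
Proof.
move=> oU fC1 Uy dy.
have [fd fc] := Ck_on_C1 oU fC1 Uy.
have yd : derivable y z v by case: dy.
pose q (h : R) : 'rV[R]_n := h^-1 *: (y (h *: v + z) - y z).
have qc : q h @[h --> (0 : R)^'] --> y'.
  by case: dy => _ <-; exact: yd.
pose u (h : R) : 'rV[R]_n := y (h *: v + z) - y z.
have uE : \forall h \near (0 : R)^', u h = h *: q h.
  near=> h; rewrite /q scalerA divff ?scale1r//.
  by near: h; exact: nbhs_dnbhs_neq.
have u0 : u h @[h --> (0 : R)^'] --> (0 : 'rV[R]_n).
  apply: cvg_trans (near_eq_cvg _) _.
    by near=> h; apply/esym; near: h; exact: uE.
  have := @cvgZ _ _ _ _ _ (fun h : R => h) q 0 y' _ qc; rewrite scale0r; apply.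
  by apply: cvg_within_filter; exact: cvg_id.
suff L : h^-1 *: (f (y (h *: v + z)) - f (y z)) @[h --> (0 : R)^'] -->
    \sum_(i < n) y' 0 i * 'D_(delta_mx 0 i) f (y z).
  apply: DeriveDef; first by apply/cvg_ex; eexists; exact: L.
  exact: cvg_lim L.
pose S (w : 'rV[R]_n) := \sum_(i < n) w 0 i * 'D_(delta_mx 0 i) f (y z).
have Sq : S (q h) @[h --> (0 : R)^'] --> S y'.
  rewrite /S; apply: cvg_bigsum => i; apply: cvgMl; exact: cvg_mx_entry.
have SZ a w : S (a *: w) = a * S w.
  by rewrite /S mulr_sumr; apply: eq_bigr => i _; rewrite mxE mulrA.
have -> : (fun h => h^-1 *: (f (y (h *: v + z)) - f (y z))) =
   (fun h => S (q h) + h^-1 * (f (y z + u h) - f (y z) - S (u h))).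
  apply/funext => h; rewrite /q -/(u h) SZ /u [y z + _]addrC subrK.
  by rewrite -mulrDr [X in _ = _ * X]addrC subrK.
rewrite -/(S y') -[S y']addr0; apply: cvgD Sq _.
apply/cvgr0Pnorm_le => e e0.
(* The quotients [q h] are eventually bounded by [|y'| + 1], so an error [e' * |u h|] is at most
   [e * |h|]. *)
pose e' := e / (`|y'| + 1).
have y1 : 0 < `|y'| + 1 by rewrite ltr_wpDl.
have e'0 : 0 < e' by rewrite divr_gt0.
have E1 := u0 _ (C1_expansion fd fc e'0).
have E2 : \forall h \near (0 : R)^', `|q h| <= `|y'| + 1.
  move/cvgrPdist_le : qc => /(_ 1 ltr01); apply: filterS => h hh.
  by rewrite -[q h](subKr y') (le_trans (ler_normB _ _))// lerD2l.
near=> h.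
have h0 : h != 0 by near: h; exact: nbhs_dnbhs_neq.
have -> : e = `|h|^-1 * (e' * (`|h| * (`|y'| + 1))).
  by rewrite mulrCA mulKf ?normr_eq0// /e' divfK// gt_eqF.
rewrite normrM normfV ler_wpM2l ?invr_ge0//.
apply: le_trans (_ : e' * `|u h| <= _).
  by near: h.
rewrite ler_wpM2l ?(ltW e'0)//.
have -> : u h = h *: q h by near: h; exact: uE.
by rewrite normrZ ler_wpM2l//; near: h.
Unshelve. all: by end_near. Qed.

Lemma derive_sum_coord (R : realType) (n : nat)
    (U : set 'rV[R]_n) (f : 'rV[R]_n -> R) (x u : 'rV[R]_n) :
  open U -> Ck_on 1 U f -> U x ->
  'D_u f x = \sum_(i < n) u 0 i * 'D_(delta_mx 0 i) f x.
Proof.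
move=> oU fC Ux.
by have [] := @is_derive_comp_C1 R _ n U f id u x u oU fC Ux (is_derive_id _ _).
Qed.

(** The formulas for derivatives of sums, products or composites hold on [U] only, while ['D_v f] is
    a function on the whole space; this lets them be substituted under [Ck_on]. *)
Lemma Ck_on_eq (R : realType) (V W : normedModType R) (U : set V) (f g : V -> W) k :
  open U -> (forall x, U x -> f x = g x) -> Ck_on k U f -> Ck_on k U g.
Proof.
move=> oU.
have near_eq (f1 f2 : V -> W) x : (forall x, U x -> f1 x = f2 x) -> U x ->
    \near x, f1 x = f2 x.
  move=> f12 Ux; have : nbhs x U by exact: open_nbhs_nbhs.
  by apply: filterS => y /f12.
elim: k f g => [|k IH] f g fg [fc fd].
all: have gc x : U x -> {for x, continuous g}
  by move=> Ux; rewrite /prop_for /continuous_at -(fg _ Ux);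
     apply: cvg_trans (fc x Ux); apply: near_eq_cvg; exact: near_eq.
all: split => // v; have [dv dC] := fd v; split.
  by move=> x Ux; apply: near_eq_derivable (dv x Ux); exact: near_eq.
by apply: IH dC => x Ux; apply: near_eq_derive; exact: near_eq.
Qed.

Lemma Ck_on_continuous (R : realType) (V W : normedModType R) (U : set V)
    (f : V -> W) k : Ck_on k U f -> forall x, U x -> {for x, continuous f}.
Proof. by case: k => [|k] []. Qed.

Lemma Ck_onW (R : realType) (V W : normedModType R) (U : set V) (f : V -> W) k :
  Ck_on k.+1 U f -> Ck_on k U f.
Proof.
elim: k f => [|k IH] f [fc fd]; split=> // v; have [dv dC] := fd v.
by split=> //; exact: IH.
Qed.

Lemma Ck_on_sub (R : realType) (V W : normedModType R) (U U' : set V) (f : V -> W) k :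
  U' `<=` U -> Ck_on k U f -> Ck_on k U' f.
Proof.
move=> UU; elim: k f => [|k IH] f [fc fd]; split=> //;
  try by move=> x /UU; exact: fc.
by move=> v; have [dv dC] := fd v; split=> [x /UU|]; [exact: dv|exact: IH].
Qed.

Lemma Ck_on_cst (R : realType) (V W : normedModType R) (U : set V) (c : W) k :
  Ck_on k U (fun=> c : W).
Proof.
elim: k c => [|k IH] c /=; split=> //;
  try by move=> x _; exact: cvg_cst.
move=> v; split=> [x _|]; first exact: derivable_cst.
rewrite (_ : 'D_v _ = fun=> 0); first exact: IH.
by apply/funext => x; exact: derive_cst.
Qed.

Lemma Ck_on_add (R : realType) (V W : normedModType R) (U : set V) (f g : V -> W) k :
  open U -> Ck_on k U f -> Ck_on k U g -> Ck_on k U (fun x => f x + g x).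
Proof.
move=> oU; elim: k f g => [|k IH] f g [fc fd] [gc gd]; split=> //.
- by move=> x Ux; apply: cvgD; [exact: fc|exact: gc].
- by move=> x Ux; apply: cvgD; [exact: fc|exact: gc].
move=> v; have [fdv fC] := fd v; have [gdv gC] := gd v; split=> [x Ux|].
  by apply: derivableD; [exact: fdv|exact: gdv].
apply: Ck_on_eq (IH _ _ fC gC) => // x Ux; apply/esym; apply: deriveD.
  exact: fdv.
exact: gdv.
Qed.

Lemma Ck_on_mul (R : realType) (V : normedModType R) (U : set V) (f g : V -> R) k :
  open U -> Ck_on k U f -> Ck_on k U g -> Ck_on k U (fun x => f x * g x).
Proof.
move=> oU; elim: k f g => [|k IH] f g hf hg;
  move: (hf) (hg) => [fc fd] [gc gd]; split=> //.
- by move=> x Ux; apply: cvgM; [exact: fc|exact: gc].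
- by move=> x Ux; apply: cvgM; [exact: fc|exact: gc].
move=> v; have [fdv fC] := fd v; have [gdv gC] := gd v; split=> [x Ux|].
  by apply: derivableM; [exact: fdv|exact: gdv].
apply: Ck_on_eq (Ck_on_add oU (IH _ _ (Ck_onW hf) gC) (IH _ _ (Ck_onW hg) fC)) => //.
move=> x Ux; apply/esym; apply: deriveM; first exact: fdv.
exact: gdv.
Qed.

Lemma Ck_on_sum (R : realType) (V W : normedModType R) (U : set V) (I : Type)
    (r : seq I) (P : pred I) (f : I -> V -> W) k : open U ->
  (forall i, Ck_on k U (f i)) -> Ck_on k U (fun x => \sum_(i <- r | P i) f i x).
Proof.
move=> oU h; elim: r => [|i r IH].
  by under eq_fun do rewrite big_nil; exact: Ck_on_cst.
under eq_fun do rewrite big_cons; case: (P i) => //.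
exact: Ck_on_add.
Qed.

Lemma Ck_on_prod (R : realType) (V : normedModType R) (U : set V) (I : Type)
    (r : seq I) (P : pred I) (f : I -> V -> R) k : open U ->
  (forall i, Ck_on k U (f i)) -> Ck_on k U (fun x => \prod_(i <- r | P i) f i x).
Proof.
move=> oU h; elim: r => [|i r IH].
  by under eq_fun do rewrite big_nil; exact: Ck_on_cst.
under eq_fun do rewrite big_cons; case: (P i) => //.
exact: Ck_on_mul.
Qed.

Lemma Ck_on_inv (R : realType) (V : normedModType R) (U : set V) (f : V -> R) k :
  open U -> (forall x, U x -> f x != 0) ->
  Ck_on k U f -> Ck_on k U (fun x => (f x)^-1).
Proof.
move=> oU f0; elim: k => [|k IH] hf; move: (hf) => [fc fd]; split=> //.
- by move=> x Ux; apply: cvgV; [exact: f0|exact: fc].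
- by move=> x Ux; apply: cvgV; [exact: f0|exact: fc].
move=> v; have [fdv fC] := fd v; split=> [x Ux|].
  by apply: derivableV; [exact: f0|exact: fdv].
have IHf := IH (Ck_onW hf).
have h := Ck_on_mul oU (Ck_on_cst U (-1 : R) k)
   (Ck_on_mul oU (Ck_on_mul oU IHf IHf) fC).
apply: Ck_on_eq h => // x Ux; rewrite (@deriveV _ _ f x v (f0 x Ux) (fdv x Ux)).
by rewrite mulN1r -invfM -expr2 scaleNr.
Qed.

Lemma Ck_on_mx (R : realType) (V : normedModType R) (U : set V) (m n : nat)
    (A : V -> 'M[R]_(m, n)) k : open U ->
  Ck_on k U A <-> forall i j, Ck_on k U (fun x => A x i j).
Proof.
move=> oU; split.
  elim: k A => [|k IH] A [Ac Ad] i j; split=> //.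
  - by move=> x Ux; apply: cvg_mx_entry; exact: Ac.
  - by move=> x Ux; apply: cvg_mx_entry; exact: Ac.
  move=> v; have [dv dC] := Ad v; split=> [x Ux|].
    by have /derivable_mxP := dv x Ux.
  apply: Ck_on_eq (IH _ dC i j) => // x Ux.
  by rewrite derive_mx ?mxE//; exact: dv.
elim: k A => [|k IH] A h; split=> //.
- by move=> x Ux; apply: cvg_mx => i j; have [+ _] := h i j; exact.
- by move=> x Ux; apply: cvg_mx => i j; have [+ _] := h i j; exact.
move=> v.
have dA x : U x -> derivable A x v.
  by move=> Ux; apply/derivable_mxP => i j; have [_ /(_ v) [+ _]] := h i j; exact.
split=> //; apply: IH => i j; have [_ /(_ v) [_]] := h i j.
by apply: Ck_on_eq => // x Ux; rewrite derive_mx ?mxE//; exact: dA.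
Qed.

(** The derivative of the composite is a sum of products of coordinates of ['D_v y] with partial
    derivatives of [f] composed with the same [y]: the induction generalizes [f] and keeps [y]. *)
Lemma Ck_on_comp (R : realType) (V : normedModType R) (n : nat) (O : set V)
    (U : set 'rV[R]_n) (f : 'rV[R]_n -> R) (y : V -> 'rV[R]_n) k :
  open O -> open U -> (forall x, O x -> U (y x)) ->
  Ck_on k U f -> Ck_on k O y -> Ck_on k O (fun x => f (y x)).
Proof.
move=> oO oU yU; elim: k f => [|k IH] f hf hy;
  move: (hf) (hy) => [fc fd] [yc yd]; split=> //.
- by move=> x Ux; apply: continuous_comp; [exact: yc|apply: fc; exact: yU].
- by move=> x Ux; apply: continuous_comp; [exact: yc|apply: fc; exact: yU].
have f1 : Ck_on 1 U f.
  by split=> // v; have [dv dC] := fd v; split=> //; split=> //; exact: Ck_on_continuous dC.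
have D x v : O x -> is_derive x v (fun x => f (y x))
    (\sum_(i < n) ('D_v y x) 0 i * 'D_(delta_mx 0 i) f (y x)).
  move=> Ox; apply: is_derive_comp_C1 oU f1 (yU _ Ox) _.
  by apply/derivableP; have [+ _] := yd v; exact.
move=> v; split=> [x Ox|]; first by have [] := D x v Ox.
suff h : Ck_on k O (fun x => \sum_(i < n) ('D_v y x) 0 i * 'D_(delta_mx 0 i) f (y x)).
  by apply: Ck_on_eq h => // x Ox; have [_ ->] := D x v Ox.
apply: Ck_on_sum => // i; apply: Ck_on_mul => //.
  by have [_ dC] := yd v; have /Ck_on_mx := dC; exact.
by have [_ dC] := fd (delta_mx 0 i); exact: (IH _ dC (Ck_onW hy)).
Qed.

Lemma Ck_on_mulmx (R : realType) (V : normedModType R) (U : set V) (m n p : nat)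
    (A : V -> 'M[R]_(m, n)) (B : V -> 'M[R]_(n, p)) k : open U ->
  Ck_on k U A -> Ck_on k U B -> Ck_on k U (fun x => A x *m B x).
Proof.
move=> oU /(Ck_on_mx _ _ oU) hA /(Ck_on_mx _ _ oU) hB.
apply/Ck_on_mx => // i j; under eq_fun do rewrite mxE.
by apply: Ck_on_sum => // l; exact: Ck_on_mul.
Qed.

Lemma Ck_on_trmx (R : realType) (V : normedModType R) (U : set V) (m n : nat)
    (A : V -> 'M[R]_(m, n)) k : open U ->
  Ck_on k U A -> Ck_on k U (fun x => (A x)^T).
Proof.
move=> oU /(Ck_on_mx _ _ oU) hA; apply/Ck_on_mx => // i j.
by under eq_fun do rewrite mxE.
Qed.

Lemma Ck_on_det (R : realType) (V : normedModType R) (U : set V) (n : nat)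
    (A : V -> 'M[R]_n) k : open U ->
  Ck_on k U A -> Ck_on k U (fun x => \det (A x)).
Proof.
move=> oU /(Ck_on_mx _ _ oU) hA; rewrite /determinant.
apply: Ck_on_sum => // s; apply: Ck_on_mul => //; first exact: Ck_on_cst.
by apply: Ck_on_prod => // i.
Qed.

Lemma Ck_on_invmx (R : realType) (V : normedModType R) (U : set V) (n : nat)
    (A : V -> 'M[R]_n) k : open U -> (forall x, U x -> A x \in unitmx) ->
  Ck_on k U A -> Ck_on k U (fun x => invmx (A x)).
Proof.
move=> oU uA hA.
have h : Ck_on k U (fun x => (\det (A x))^-1 *: \adj (A x)).
  apply/Ck_on_mx => // i j; under eq_fun do rewrite !mxE.
  apply: Ck_on_mul => //.
    apply: Ck_on_inv => //; last exact: Ck_on_det.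
    by move=> x /uA; rewrite unitmxE unitfE.
  apply: Ck_on_mul => //; first exact: Ck_on_cst.
  apply: Ck_on_det => //; move: hA => /(Ck_on_mx _ _ oU) hA.
  by apply/Ck_on_mx => // a b; under eq_fun do rewrite !mxE.
by apply: Ck_on_eq h => // x Ux; rewrite /invmx uA.
Qed.

Lemma Ck_on_comp_mx (R : realType) (V : normedModType R) (n p q : nat) (O : set V)
    (U : set 'rV[R]_n) (f : 'rV[R]_n -> 'M[R]_(p, q)) (y : V -> 'rV[R]_n) k :
  open O -> open U -> (forall x, O x -> U (y x)) ->
  Ck_on k U f -> Ck_on k O y -> Ck_on k O (fun x => f (y x)).
Proof.
move=> oO oU yU /(Ck_on_mx _ _ oU) hf hy; apply/Ck_on_mx => // i j.
exact: (Ck_on_comp oO oU yU (hf i j) hy).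
Qed.

Lemma derive_sum_coord_mx (R : realType) (n p q : nat)
    (U : set 'rV[R]_n) (f : 'rV[R]_n -> 'M[R]_(p, q)) (x u : 'rV[R]_n) :
  open U -> Ck_on 1 U f -> U x ->
  'D_u f x = \sum_(i < n) u 0 i *: 'D_(delta_mx 0 i) f x.
Proof.
move=> oU fC Ux; have [_ fd] := fC.
have d v : derivable f x v by have [+ _] := fd v; exact.
apply/matrixP => i j; rewrite derive_mx// mxE summxE.
move: fC => /(Ck_on_mx _ _ oU) /(_ i j) fC.
rewrite (derive_sum_coord u oU fC Ux); apply: eq_bigr => k _.
by rewrite mxE derive_mx// mxE.
Qed.

Lemma is_derive_comp_C1_mx (R : realType) (V : normedModType R) (n p q : nat)
    (U : set 'rV[R]_n) (f : 'rV[R]_n -> 'M[R]_(p, q)) (y : V -> 'rV[R]_n)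
    (y' : 'rV[R]_n) (z v : V) :
  open U -> Ck_on 1 U f -> U (y z) -> is_derive z v y y' ->
  is_derive z v (fun t => f (y t)) ('D_y' f (y z)).
Proof.
move=> oU fC Uy dy; apply/is_derive_mx => i j; have [_ fd] := fC.
have d w : derivable f (y z) w by have [+ _] := fd w; exact.
rewrite derive_mx// mxE.
have fCij : Ck_on 1 U (fun x => f x i j).
  by move: fC => /(Ck_on_mx _ _ oU); exact.
rewrite (derive_sum_coord y' oU fCij Uy).
exact: is_derive_comp_C1 oU fCij Uy dy.
Qed.

Lemma C1_bounded_lipschitz (R : realType) (n p q : nat) (U : set 'rV[R]_n)
    (H : 'rV[R]_n -> 'M[R]_(p, q)) (y0 : 'rV[R]_n) :
  open U -> Ck_on 1 U H -> U y0 ->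
  exists r K : R, [/\ 0 < r, 0 < K, forall y, `|y - y0| <= r -> U y,
    forall y, `|y - y0| <= r -> `|H y| <= K &
    forall y z, `|y - y0| <= r -> `|z - y0| <= r -> `|H y - H z| <= K * `|y - z|].
Proof.
move=> oU HC Uy; have [Hc Hd] := HC.
have h1 : \forall y \near y0, U y by exact: open_nbhs_nbhs.
have h2 : \forall y \near y0, forall i : 'I_n,
    `|'D_(delta_mx 0 i) H y0 - 'D_(delta_mx 0 i) H y| <= 1.
  apply: (@filter_forall _ 'I_n (fun i y => _ <= 1) (nbhs y0)) => i.
  have [_ [+ _]] := Hd (delta_mx 0 i) => /(_ _ Uy) c.
  by move/cvgrPdist_le : c => /(_ 1 ltr01).
have [d d0 hd] := (near_distP _ _).1 (filterI h1 h2).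
pose D := \sum_(i < n) (`|'D_(delta_mx 0 i) H y0| + 1).
have D0 : 0 <= D by apply: sumr_ge0 => i _; rewrite addr_ge0.
(* With [|t| < 2] and [|w| <= 2 * r], the point [z + t *: w] stays within [5 * r < d] of [y0]. The
   times fill an open interval around 0 and 1, as the mean value inequality is stated on open
   intervals. *)
pose r := d / 6.
have r0 : 0 < r by rewrite divr_gt0.
have inU y : `|y - y0| < d -> U y by move=> yd; apply: (hd _ _).1; rewrite distrC.
have DH y u : `|y - y0| < d -> `|'D_u H y| <= D * `|u|.
  move=> yd; rewrite (derive_sum_coord_mx u oU HC (inU _ yd)).
  rewrite (le_trans (ler_norm_sum _ _ _))// mulr_suml; apply: ler_sum => i _.
  rewrite normrZ mulrC; apply: ler_pM => //; last exact: mx_entry_le.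
  have h : `|'D_(delta_mx 0 i) H y0 - 'D_(delta_mx 0 i) H y| <= 1.
    by rewrite distrC in yd; have [_] := hd y yd; exact.
  rewrite -['D_(delta_mx 0 i) H y](subKr ('D_(delta_mx 0 i) H y0)).
  by rewrite (le_trans (ler_normB _ _))// lerD2l h.
have lip y z : `|y - y0| <= r -> `|z - y0| <= r -> `|H y - H z| <= D * `|y - z|.
  move=> yr zr; pose w := y - z.
  have wr : `|w| <= 2 * r.
    have -> : w = (y - y0) - (z - y0) by rewrite opprB addrA subrK.
    by rewrite (le_trans (ler_normB _ _))// mulr2n mulrDl mul1r lerD.
  have gd t : -2 < t < 2 -> `|z + t *: w - y0| < d.
    move=> t2; rewrite addrAC (le_lt_trans (ler_normD _ _))// normrZ.
    have : `|t| * `|w| <= 2 * (2 * r) by apply: ler_pM => //; rewrite ltW// ltr_norml.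
    by rewrite /r in zr *; lra.
  have -> : H y - H z = H (z + (1 : R) *: w) - H (z + (0 : R) *: w).
    by rewrite scale1r scale0r addr0 /w [z + _]addrC subrK.
  have -> : D * `|y - z| = D * `|y - z| * `|1 - 0 : R| by rewrite subr0 normr1 mulr1.
  apply: (@derive_norm_le R p q (fun t => H (z + t *: w))
     (fun t => 'D_w H (z + t *: w)) (- 2) 2 (D * `|y - z|) _ _ 0 1).
  - move=> t t2; apply: is_derive_line; have [+ _] := Hd w; apply.
    by apply: inU; exact: gd.
  - by move=> t t2; apply: DH; exact: gd.
  - by lra.
  - by lra.
exists r, (D + `|H y0| + D * r + 1); split.
- exact: r0.
- by rewrite ltr_wpDl// !addr_ge0// mulr_ge0// ltW.
- by move=> y yr; apply: inU; rewrite /r in yr; lra.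
- move=> y yr; rewrite -[H y](subrK (H y0)) (le_trans (ler_normD _ _))//.
  have := lip y y0 yr; rewrite subrr normr0 => /(_ (ltW r0)) h.
  have : D * `|y - y0| <= D * r by rewrite ler_wpM2l.
  by lra.
- move=> y z yr zr; apply: le_trans (lip y z yr zr) _; rewrite ler_wpM2r//.
  by rewrite -!addrA lerDl !addr_ge0// mulr_ge0// ltW.
Qed.

(** * Ordinary differential equations *)

Lemma le_of_le_geo (R : realType) (x a M : R) :
  (forall k : nat, x <= a + M * 2^-1 ^+ k) -> x <= a.
Proof.
move=> h.
have c : a + M * 2^-1 ^+ k @[k --> \oo] --> a.
  rewrite -[X in _ --> X]addr0 -[X in a + X](mulr0 M).
  apply: cvgD; first exact: cvg_cst.
  apply: cvgMr; apply: cvg_expr; rewrite ger0_norm; lra.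
rewrite -(cvg_lim _ c)//; apply: limr_ge; first by apply/cvg_ex; exists a.
by near=> k; exact: h.
Unshelve. all: by end_near. Qed.

(** The intervals of centre [u k] and radius [2 * C * 2^-1 ^+ k] are nested, and the supremum of
    their left ends lies in all of them. This yields the limit together with its rate. *)
Lemma geo_cauchy_limit (R : realType) (u : nat -> R) (C : R) :
  (forall k, `|u k.+1 - u k| <= C * 2^-1 ^+ k) ->
  exists l, forall k, `|u k - l| <= 2 * C * 2^-1 ^+ k.
Proof.
move=> h; have C0 : 0 <= C by move: (h 0%N); rewrite expr0 mulr1; apply: le_trans.
pose a k := u k - 2 * C * 2^-1 ^+ k.
pose b k := u k + 2 * C * 2^-1 ^+ k.
have aS k : a k <= a k.+1.
  by rewrite /a exprS; move: (h k); rewrite ler_norml; lra.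
have bS k : b k.+1 <= b k.
  by rewrite /b exprS; move: (h k); rewrite ler_norml; lra.
have ab k : a k <= b k.
  rewrite /a /b; have : 0 <= 2 * C * 2^-1 ^+ k :> R by rewrite !mulr_ge0// exprn_ge0.
  by lra.
have amono : {homo a : i j / (i <= j)%N >-> i <= j} by apply/nondecreasing_seqP.
have bmono : {homo b : i j / (i <= j)%N >-> j <= i} by apply/nonincreasing_seqP.
have abjk j k : a j <= b k.
  apply: le_trans (amono _ _ (leq_maxl j k)) _.
  by apply: le_trans (ab _) _; apply: bmono; exact: leq_maxr.
exists (sup (range a)) => k.
have lo : a k <= sup (range a).
  by apply: ub_le_sup; [exists (b 0%N) => _ [j _ <-]|exists k].
have hi : sup (range a) <= b k.
  by apply: ge_sup; [exists (a 0%N); exists 0%N|move=> _ [j _ <-]].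
by move: lo hi; rewrite /a /b ler_norml; lra.
Qed.

Lemma geo_cauchy_limit_mx (R : realType) (m n : nat) (u : nat -> 'M[R]_(m, n)) (C : R) :
  (forall k, `|u k.+1 - u k| <= C * 2^-1 ^+ k) ->
  exists l, forall k, `|u k - l| <= 2 * C * 2^-1 ^+ k.
Proof.
move=> h; have C0 : 0 <= C by move: (h 0%N); rewrite expr0 mulr1; apply: le_trans.
have hij (ij : 'I_m * 'I_n) k : `|u k.+1 ij.1 ij.2 - u k ij.1 ij.2| <= C * 2^-1 ^+ k.
  by apply: le_trans (h k); have := mx_entry_le (u k.+1 - u k) ij.1 ij.2; rewrite !mxE.
have [l hl] := choice (fun ij => geo_cauchy_limit (hij ij)).
exists (\matrix_(i, j) l (i, j)) => k; apply: mx_norm_le; first by rewrite !mulr_ge0 ?exprn_ge0.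
by move=> i j; rewrite !mxE; exact: (hl (i, j)).
Qed.

(** The integral starts at -1 so that 0, the initial time of the differential equations, is an
    interior point with a two-sided derivative. *)
Lemma continuous_primitive (R : realType) (g : R -> R) : continuous g ->
  exists P : R -> R, forall t : R, -1 < t -> is_derive t 1 P (g t).
Proof.
move=> gc.
exists (fun x => (\int[lebesgue_measure]_(t in [set` `[-1, x]]) g t)%R) => t t1.
have [||||D E] := @continuous_FTC1_closed R g (-1) t (t + 1).
- by lra.
- apply: continuous_compact_integrable; first exact: segment_compact.
  exact: continuous_subspaceT.
- exact: t1.
- exact: gc.
- by rewrite derive1E in E; exact: (DeriveDef D E).
Qed.

Lemma continuous_primitive_mx (R : realType) (m n : nat) (z : 'M[R]_(m, n))
    (g : R -> 'M[R]_(m, n)) : continuous g ->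
  exists P : R -> 'M[R]_(m, n),
    P 0 = z /\ forall t : R, -1 < t -> is_derive t 1 P (g t).
Proof.
move=> gc.
have gij (ij : 'I_m * 'I_n) : continuous (fun t => g t ij.1 ij.2).
  by move=> t; apply: cvg_mx_entry; exact: gc.
have [P hP] := choice (fun ij => continuous_primitive (gij ij)).
exists (fun t => \matrix_(i, j) (P (i, j) t - P (i, j) 0 + z i j)); split.
  by apply/matrixP => i j; rewrite !mxE subrr add0r.
move=> t t1; apply/is_derive_mx => i j.
rewrite (_ : (fun s => _) = (fun s => P (i, j) s + (z i j - P (i, j) 0))); last first.
  by apply/funext => s; rewrite mxE addrAC addrA.
have D := hP (i, j) t t1.
rewrite -[g t i j]addr0; apply: is_deriveD.
Qed.

Lemma continuous_distP (R : realType) (V W : normedModType R) (f : V -> W) (x : V) :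
  {for x, continuous f} <-> forall e : R, 0 < e ->
    exists2 d : R, 0 < d & forall z, `|x - z| < d -> `|f x - f z| <= e.
Proof.
split=> [/cvgrPdist_le h e e0|h]; first by apply/near_distP; exact: h.
by apply/cvgrPdist_le => e /h hd; apply/near_distP.
Qed.

Lemma clamp_dist_le (R : realType) (r a b : R) : 0 < r ->
  `|Num.max (- r) (Num.min r a) - Num.max (- r) (Num.min r b)| <= `|a - b|.
Proof.
move=> r0; have c x : Num.max (- r) (Num.min r x) =
    if x <= - r then - r else if x <= r then x else r.
  have [xr|xr] := leP x (- r).
    by rewrite min_r ?max_l//; move: r0 xr; lra.
  have [xr'|xr'] := leP x r; first by rewrite max_r// ltW.
  by rewrite max_r//; move: r0; lra.
rewrite !c; have := ler_norm (a - b); have := ler_norm (b - a).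
rewrite [`|b - a|]distrC ler_norml.
by case: (leP a (- r)) => a1; case: (leP b (- r)) => b1;
  try case: (leP a r) => a2; try case: (leP b r) => b2 h1 h2;
  apply/andP; split; lra.
Qed.

(* Clamping the coordinates makes the field globally Lipschitz, so that the
   Picard iterates are defined without checking that they stay in the ball. *)
Definition clamp (R : realType) (n : nat) (y0 : 'rV[R]_n) (r : R) (y : 'rV[R]_n) :
  'rV[R]_n := \row_i (y0 0 i + Num.max (- r) (Num.min r (y 0 i - y0 0 i))).

Section Clamp.
Context {R : realType} {n : nat} (y0 : 'rV[R]_n) (r : R).
Hypothesis r0 : 0 < r.

Lemma clamp_ball y : `|clamp y0 r y - y0| <= r.
Proof.
apply: mx_norm_le => [|i j]; first exact: ltW.
rewrite (ord1 i) !mxE addrAC subrr add0r ler_norml.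
rewrite le_max lexx/= ge_max; apply/andP; split; first by move: r0; lra.
by rewrite ge_min lexx.
Qed.

Lemma clamp_id y : `|y - y0| <= r -> clamp y0 r y = y.
Proof.
move=> yr; apply/rowP => i; rewrite !mxE.
have : `|y 0 i - y0 0 i| <= r.
  by apply: le_trans yr; have := mx_entry_le (y - y0) 0 i; rewrite !mxE.
rewrite ler_norml => /andP[h1 h2].
by rewrite min_r// max_r// addrC subrK.
Qed.

Lemma clamp_lip y z : `|clamp y0 r y - clamp y0 r z| <= `|y - z|.
Proof.
apply: mx_norm_le => // i j; rewrite (ord1 i) !mxE.
apply: (@le_trans _ _ (`|y 0 j - z 0 j|)); last first.
  by have := mx_entry_le (y - z) 0 j; rewrite !mxE.
rewrite opprD addrACA subrr add0r (le_trans (clamp_dist_le _ _ r0))//.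
by rewrite opprB addrA subrK.
Qed.

End Clamp.

Lemma is_derive_scalel (R : realType) (V : normedModType R) (c : V) (t : R) :
  is_derive t 1 (fun s : R => s *: c) c.
Proof.
have h := @is_derive_line R V V id 0 c t (@derivable_id _ _ _ _).
rewrite (_ : (fun s => s *: c) = (fun s : R => id (0 + s *: c))).
  by apply: is_derive_eq; rewrite derive_id.
by apply/funext => s; rewrite add0r.
Qed.

Section Picard.
Context {R : realType} {n : nat}.
Local Notation V := 'rV[R]_n.
Variables (F : V -> V) (y0 : V) (r K e : R).
Hypotheses (r0 : 0 < r) (K0 : 0 < K)
  (FK : forall y, `|y - y0| <= r -> `|F y| <= K)
  (FL : forall y z, `|y - y0| <= r -> `|z - y0| <= r -> `|F y - F z| <= K * `|y - z|)
  (e0 : 0 < e) (e1 : e <= 2^-1) (Ke : K * e <= 2^-1) (Kr : K * e <= r / 2).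

Let G y := F (clamp y0 r y).

Let GK y : `|G y| <= K. Proof. by apply: FK; exact: clamp_ball. Qed.

Let GL y z : `|G y - G z| <= K * `|y - z|.
Proof.
apply: le_trans (FL (clamp_ball _ r0 _) (clamp_ball _ r0 _)) _.
by apply: ler_wpM2l; [exact: ltW|exact: clamp_lip].
Qed.

Let Gc : continuous G.
Proof.
move=> y; apply/continuous_distP => d d0; exists (d / K).
  by rewrite divr_gt0.
move=> z zy; apply: le_trans (GL _ _) _.
by rewrite mulrC -ler_pdivlMr// ltW.
Qed.

(** The time [e] does not depend on the starting point [z] in the half ball. The bound
    [K * e <= r / 2] keeps the solution in the ball, and [K * e <= 2^-1] makes the iterates converge
    geometrically. *)
Lemma picard (z : V) : `|z - y0| <= r / 2 ->
  exists y : R -> V, y 0 = z /\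
    forall t : R, `|t| < e -> `|y t - y0| <= r /\ is_derive t 1 y (F (y t)).
Proof.
move=> zr.
have [P hP] := choice (fun g : {g : R -> V | continuous g} =>
  continuous_primitive_mx z (svalP g)).
(* [P] takes continuous functions only; a default value makes it total, so that it can be
   iterated. *)
pose P' g := if pselect (continuous g) is left c then P (exist _ g c) else cst z.
have hP' g : continuous g ->
    P' g 0 = z /\ forall t : R, -1 < t -> is_derive t 1 (P' g) (g t).
  by rewrite /P'; case: pselect => // c _; have := hP (exist _ g c).
(* Iterates are continuous at times above -1, but a primitive is available for integrands continuous
   everywhere. Freezing the time below -1/2 repairs this and changes nothing for [|t| < e]. *)
pose m (t : R) := Num.max t (- 2^-1).
pose s k := iter k (fun y => P' (fun t => G (y (m t)))) (fun=> z).
have sc k : (forall t : R, -1 < t -> {for t, continuous (s k)}) /\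
    continuous (fun t => G (s k (m t))).
  elim: k => [|k [IH1 IH2]] /=.
    by split=> [t _|t]; exact: cvg_cst.
  have h (t : R) : -1 < t -> {for t, continuous (P' (fun t => G (s k (m t))))}.
    move=> t1; apply: differentiable_continuous; apply/derivable1_diffP.
    by have [_ /(_ t t1)[]] := hP' _ IH2.
  split=> // t; apply: continuous_comp; last exact: Gc.
  apply: continuous_comp; last by apply: h; rewrite /m lt_max; apply/orP; right; lra.
  by apply: continuous_max; [exact: cvg_id|exact: cvg_cst].
have s0 k : s k 0 = z.
  by case: k => //= k; have [] := hP' _ (sc k).2.
have sD k (t : R) : - e < t -> is_derive t 1 (s k.+1) (G (s k t)).
  move=> te; have mt : m t = t by rewrite /m max_l//; move: te e1; lra.
  by have [_ /(_ t)] := hP' _ (sc k).2; rewrite mt; apply; move: te e1; lra.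
have sz (t : R) : s 0%N t = z by [].
clearbody s; clear sc.
pose C := K * e.
have C0 : 0 <= C by rewrite mulr_ge0// ltW.
have E k (t : R) : `|t| < e -> `|s k.+1 t - s k t| <= C * 2^-1 ^+ k.
  rewrite ltr_norml => te; have t0 : `|t - 0| <= e by rewrite subr0 ltW// ltr_norml.
  have z0 : - e < 0 < e by rewrite oppr_lt0 e0.
  elim: k => [|k IH] in t te t0 *.
    rewrite expr0 mulr1 sz -(s0 1%N).
    apply: le_trans (_ : K * `|t - 0| <= _).
      apply: (@derive_norm_le R 1 n (s 1%N) (fun t => G (s 0%N t)) (- e) e) => // v /andP[ve _].
      exact: sD.
    by apply: ler_wpM2l; first exact: ltW.
  have h : `|(s k.+2 t - s k.+1 t) - (s k.+2 0 - s k.+1 0)| <= K * (C * 2^-1 ^+ k) * `|t - 0|.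
    apply: (@derive_norm_le R 1 n (fun t => s k.+2 t - s k.+1 t)
        (fun t => G (s k.+1 t) - G (s k t)) (- e) e) => // v ve.
      by apply: is_deriveB; apply: sD; case/andP: ve.
    apply: le_trans (GL _ _) _; apply: ler_wpM2l; first exact: ltW.
    by apply: IH => //; rewrite subr0 ltW// ltr_norml.
  move: h; rewrite (s0 k.+2) (s0 k.+1) subrr subr0 => h; apply: le_trans h _.
  rewrite exprS mulrAC [X in _ <= X]mulrCA; set c := C * _.
  have c0 : 0 <= c by rewrite mulr_ge0// exprn_ge0.
  apply: ler_wpM2r => //; apply: le_trans Ke; apply: ler_wpM2l => //; exact: ltW.
have hl (t : R) : exists l : V, `|t| < e -> forall k, `|s k t - l| <= 2 * C * 2^-1 ^+ k.
  have [te|te] := boolP (`|t| < e); last by exists z.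
  have [l hl] := geo_cauchy_limit_mx (fun k => E k t te).
  by exists l.
have [y hy] := choice hl.
exists y; split.
  apply/eqP; rewrite -subr_eq0 -normr_le0; apply: (@le_of_le_geo R _ _ (2 * C)) => k.
  by rewrite add0r distrC; have := hy 0 _ k; rewrite (s0 k); apply; rewrite normr0.
have sK k (t u : R) : `|t| < e -> `|u| < e -> `|s k t - s k u| <= K * `|t - u|.
  rewrite !ltr_norml => te ue; case: k => [|k].
    by rewrite !sz subrr normr0 mulr_ge0// ltW.
  apply: (@derive_norm_le R 1 n (s k.+1) (fun t => G (s k t)) (- e) e) => // v /andP[ve _].
  exact: sD.
have yb (t : R) : `|t| < e -> `|y t - y0| <= r.
  move=> te; rewrite -[y t](subrK z) -addrA (le_trans (ler_normD _ _))//.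
  suff : `|y t - z| <= r / 2 by move: zr; lra.
  apply: (@le_of_le_geo R _ _ (2 * C)) => k.
  rewrite -[y t](subrK (s k t)) -addrA (le_trans (ler_normD _ _))//.
  rewrite [X in _ <= X]addrC; apply: lerD; first by rewrite distrC; exact: hy.
  rewrite -(s0 k); apply: le_trans (sK k _ _ te _) _; first by rewrite normr0.
  rewrite subr0; apply: le_trans Kr; rewrite ler_wpM2l ?ltW//.
move=> t te; split; first exact: yb.
have -> : F (y t) = G (y t) by rewrite /G clamp_id// yb.
(* The limit is differentiable with an explicit quadratic remainder: at times within [2 * |h|] of
   [t], the slope of [s k.+1] differs from [G (y t)] by at most [2 * K * K * |h|] plus a geometric
   error, which disappears as [k] grows. *)
have key (h : R) : h != 0 -> `|h + t| < e ->
    `|y (h + t) - y t - h *: G (y t)| <= 2 * K * K * `|h| * `|h|.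
  move=> h0 hte.
  have [a [b [ha hb ab]]] : exists a b : R, [/\ a < t < b, a < h + t < b &
     forall u : R, a < u < b -> `|u| < e /\ `|u - t| <= 2 * `|h|].
    have hp : 0 < `|h| by rewrite normr_gt0.
    move: te hte; rewrite !ltr_norml => /andP[t1 t2] /andP[h1 h2].
    have h3 := ler_norm h; have h4 := ler_norm (- h); rewrite normrN in h4.
    exists (Num.max (- e) (t - 2 * `|h|)), (Num.min e (t + 2 * `|h|)); split.
    - by rewrite gt_max lt_min; apply/andP; split; apply/andP; split; lra.
    - by rewrite gt_max lt_min; apply/andP; split; apply/andP; split; lra.
    - move=> u; rewrite gt_max lt_min => /andP[/andP[u1 u2] /andP[u3 u4]].
      by rewrite ltr_norml ler_norml; split; apply/andP; split; lra.
  apply: (@le_of_le_geo R _ _ (4 * C + 2 * C * K * `|h|)) => k.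
  pose w u := s k.+1 u - u *: G (y t).
  have hw : `|w (h + t) - w t| <= K * (2 * K * `|h| + 2 * C * 2^-1 ^+ k) * `|h + t - t|.
    apply: (@derive_norm_le R 1 n w (fun u => G (s k u) - G (y t)) a b) => // u /ab[ue ut].
      apply: is_deriveB; first by apply: sD; move: ue; rewrite ltr_norml => /andP[].
      exact: is_derive_scalel.
    apply: le_trans (GL _ _) _; apply: ler_wpM2l; first exact: ltW.
    rewrite -[s k u](subrK (s k t)) -addrA (le_trans (ler_normD _ _))//.
    apply: lerD; last exact: hy.
    apply: le_trans (sK k _ _ ue te) _.
    by rewrite -mulrA mulrCA; apply: ler_wpM2l => //; exact: ltW.
  have -> : y (h + t) - y t - h *: G (y t) =
     (y (h + t) - s k.+1 (h + t)) + (s k.+1 t - y t) + (w (h + t) - w t).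
    by rewrite /w; apply/matrixP => i j; rewrite !mxE; ring.
  rewrite addrK in hw.
  apply: le_trans (ler_normD _ _) _; apply: le_trans (lerD (ler_normD _ _) hw) _.
  have h1 := hy _ hte k.+1; have h2 := hy _ te k.+1.
  rewrite distrC in h1; rewrite exprS in h1 h2.
  have := normr_ge0 h.
  move: h1 h2; set A := `|_ - _|; set B := `|_ - _|; set p := 2^-1 ^+ k.
  move=> h1 h2 hge; apply: le_trans (_ : (2 * C * (2^-1 * p)) + (2 * C * (2^-1 * p)) +
    K * (2 * K * `|h| + 2 * C * p) * `|h| <= _).
    by rewrite lerD2r lerD.
  have : 0 <= C * p by rewrite mulr_ge0// exprn_ge0.
  have -> : K * (2 * K * `|h| + 2 * C * p) * `|h| =
      2 * K * K * `|h| * `|h| + 2 * C * K * `|h| * p by ring.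
  by lra.
have L : h^-1 *: (y (h *: 1 + t) - y t) @[h --> (0 : R)^'] --> G (y t).
  apply/cvgrPdist_le => d d0.
  have M0 : 0 < 2 * K * K by rewrite !mulr_gt0.
  near=> h.
  have h0 : h != 0 by near: h; exact: nbhs_dnbhs_neq.
  have hd : `|h| <= d / (2 * K * K).
    by near: h; apply: dnbhs0_le; rewrite divr_gt0.
  have he : `|h| < e - `|t| by near: h; apply: dnbhs0_lt; rewrite subr_gt0.
  rewrite [h *: 1]mulr1.
  have -> : G (y t) - h^-1 *: (y (h + t) - y t) =
     - (h^-1 *: (y (h + t) - y t - h *: G (y t))).
    by rewrite [in RHS]scalerBr scalerA mulVf// scale1r opprB.
  rewrite normrN normrZ normfV mulrC ler_pdivrMr; last by rewrite normr_gt0.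
  apply: le_trans (key h h0 _) _.
    by rewrite (le_lt_trans (ler_normD _ _))// -ltrBrDr.
  by apply: ler_wpM2r => //; rewrite mulrC -ler_pdivlMr.
apply: DeriveDef; first by apply/cvg_ex; eexists; exact: L.
exact: cvg_lim L.
Unshelve. all: by end_near. Qed.
End Picard.

(* A crude bound [D] on the distance bootstraps itself: each use of the mean
   value inequality halves its contribution. *)
Lemma derive_gronwall (R : realType) (m n : nat) (y1 y2 f1 f2 : R -> 'M[R]_(m, n))
    (a b L eta D : R) :
  0 <= L -> 0 <= eta -> L * (b - a) <= 2^-1 ->
  (forall t, a < t < b -> is_derive t 1 y1 (f1 t)) ->
  (forall t, a < t < b -> is_derive t 1 y2 (f2 t)) ->
  (forall t, a < t < b -> `|f1 t - f2 t| <= L * `|y1 t - y2 t| + eta) ->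
  (forall t, a < t < b -> `|y1 t - y2 t| <= D) ->
  forall s t, a < s < b -> a < t < b ->
  `|y1 t - y2 t| <= 2 * (`|y1 s - y2 s| + (b - a) * eta).
Proof.
move=> L0 eta0 Lab d1 d2 f12 yD s t sab tab.
set E := `|y1 s - y2 s| + (b - a) * eta.
have ab : 0 < b - a by case/andP: sab; lra.
have E0 : 0 <= E by rewrite addr_ge0// mulr_ge0// ltW.
apply: (@le_of_le_geo R _ _ D) => k; elim: k t tab => [|k IH] t tab.
  by rewrite expr0 mulr1; have := yD t tab; lra.
have D0 : 0 <= D by apply: le_trans (yD s sab).
set W := 2 * E + D * 2^-1 ^+ k in IH.
have W0 : 0 <= W by rewrite addr_ge0 ?mulr_ge0// exprn_ge0.
have h : `|(y1 t - y2 t) - (y1 s - y2 s)| <= (L * W + eta) * `|t - s|.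
  apply: (@derive_norm_le R m n (fun t => y1 t - y2 t) (fun t => f1 t - f2 t) a b) => // u uab.
    by apply: is_deriveB; [exact: d1|exact: d2].
  by apply: le_trans (f12 u uab) _; rewrite lerD2r; apply: ler_wpM2l => //; exact: IH.
have ts : `|t - s| <= b - a by case/andP: sab; case/andP: tab; rewrite ler_norml; lra.
have h2 : (L * W + eta) * `|t - s| <= (L * W + eta) * (b - a).
  by apply: ler_wpM2l => //; rewrite addr_ge0// mulr_ge0.
have h3 : L * (b - a) * W <= 2^-1 * W by apply: ler_wpM2r.
rewrite -[y1 t - y2 t](subrK (y1 s - y2 s)) (le_trans (ler_normD _ _))//.
apply: le_trans (lerD (le_trans h h2) (lexx _)) _.
have -> : (L * W + eta) * (b - a) + `|y1 s - y2 s| = E + L * (b - a) * W.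
  by rewrite /E; ring.
by rewrite exprS; move: h3; rewrite /W; lra.
Qed.

(** Connectedness of the interval with openness and closedness of [P] merged into one local
    condition: near each [t0], a single point satisfying [P] forces it on all others. It serves
    existence, uniqueness and continuous dependence of lifts. *)
Lemma interval_propagation (R : realType) (a b : R) (P : R -> Prop) :
  P a ->
  (forall t0, a <= t0 <= b -> exists2 e : R, 0 < e & forall s t, a <= s <= b ->
     a <= t <= b -> `|s - t0| < e -> `|t - t0| < e -> P s -> P t) ->
  forall t, a <= t <= b -> P t.
Proof.
move=> Pa loc t tab; have ab : a <= b by case/andP: tab; apply: le_trans.
pose S := [set u | a <= u <= b /\ forall s, a <= s <= u -> P s].
have Sa : S a.
  split; first by rewrite lexx ab.
  by move=> s /andP[h1 h2]; have -> : s = a by apply/eqP; rewrite eq_le h1 h2.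
have Sb : has_sup S by split; [exists a|exists b => u [/andP[]]].
pose T := sup S.
have aT : a <= T by apply: ub_le_sup => //; case: Sb.
have Tb : T <= b by apply: ge_sup; [exists a|move=> u [/andP[]]].
have [e e0 he] := loc T (introT andP (conj aT Tb)).
have [u [[/andP[au ub] Pu] Tu]] : exists u, S u /\ T - e < u.
  by have [u Su Tu] := sup_adherent e0 Sb; exists u.
have uT : u <= T by apply: ub_le_sup; [case: Sb|split=> //; rewrite au ub].
have Pu' : P u by apply: Pu; rewrite au lexx.
have nearT v : a <= v <= b -> `|v - T| < e -> P v.
  move=> vab vT; apply: he Pu' => //; first by rewrite au ub.
  by rewrite ltr_norml; apply/andP; split; lra.
have Pall v : a <= v <= b -> v < T + e -> P v.
  move=> /andP[av vb] vT; have [vu|uv] := leP v u; first by apply: Pu; rewrite av vu.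
  by apply: nearT; [rewrite av vb|rewrite ltr_norml; apply/andP; split; lra].
case/andP: tab => at_ tb; apply: (Pall); rewrite ?at_//.
have [//|Tt] := ltP t (T + e).
pose v := T + e / 2.
have Sv : S v.
  have av : a <= v by rewrite /v; lra.
  have vb : v <= b by rewrite /v; lra.
  split; first by rewrite av vb.
  move=> s /andP[as_ sv]; apply: Pall; first by rewrite as_ (le_trans sv vb).
  by move: sv; rewrite /v; lra.
have : v <= T by apply: ub_le_sup => //; case: Sb.
by rewrite /v; lra.
Qed.

(** * Horizontal lifts of coordinate segments *)

Section ChartBasics.
Context {R : realType} {n : nat} {M : riemannianManifold R n}.
Implicit Types (d e : chart R n M) (y u w : 'rV[R]_n).

Lemma overlap_open d e : open (overlap d e).
Proof.
rewrite openE => y [yd ye].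
have h1 : nbhs y (chart_cod d) by apply: open_nbhs_nbhs; split=> //; exact: chart_cod_open.
have h2 : nbhs y (of_coord d @^-1` chart_dom e).
  apply: (of_coord_cts yd); apply: open_nbhs_nbhs; split=> //; exact: chart_dom_open.
by apply: filterS (filterI h1 h2) => z [].
Qed.

Lemma transition_overlap d e y : overlap d e y -> overlap e d (transition d e y).
Proof.
move=> [yd ye]; split; first exact: to_coord_cod.
by rewrite /transition to_coordK//; exact: of_coord_dom.
Qed.

Lemma transitionK d e y : overlap d e y -> transition e d (transition d e y) = y.
Proof. by move=> [yd ye]; rewrite /transition to_coordK// of_coordK. Qed.

Lemma of_coord_transition d e y : overlap d e y ->
  of_coord e (transition d e y) = of_coord d y.
Proof. by move=> [yd ye]; rewrite /transition to_coordK. Qed.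

Lemma overlap_to_coord d e (x : M) : chart_dom d x -> chart_dom e x ->
  overlap d e (to_coord d x).
Proof. by move=> xd xe; split; [exact: to_coord_cod|rewrite to_coordK]. Qed.

Lemma transition_to_coord d e (x : M) : chart_dom d x ->
  transition d e (to_coord d x) = to_coord e x.
Proof. by move=> xd; rewrite /transition to_coordK. Qed.

Lemma transition_C1 d e : atlas d -> atlas e -> Ck_on 1 (overlap d e) (transition d e).
Proof. by move=> ad ae; exact: atlas_smooth. Qed.

Lemma derive_transitionK d e y w : atlas d -> atlas e -> overlap d e y ->
  'D_('D_w (transition e d) (transition d e y)) (transition d e) y = w.
Proof.
move=> ad ae ode; have oed := transition_overlap ode.
have [_ /(_ w)[de _]] := transition_C1 ae ad.
have D : is_derive (transition d e y) w (transition e d)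
    ('D_w (transition e d) (transition d e y)).
  by apply/derivableP; exact: de.
have odey : overlap d e (transition e d (transition d e y)) by rewrite transitionK.
have := is_derive_comp_C1_mx (@overlap_open d e) (transition_C1 ad ae) odey D.
rewrite transitionK// => -[_ <-].
rewrite -[RHS](derive_id (transition d e y) w); apply: near_eq_derive.
have : nbhs (transition d e y) (overlap e d).
  by apply: open_nbhs_nbhs; split=> //; exact: overlap_open.
by apply: filterS => z hz; rewrite transitionK.
Qed.

End ChartBasics.

Section Submersion.
Context {R : realType} {n m : nat}.
Context {M : riemannianManifold R n} {B : riemannianManifold R m}.
Context (p : M -> B).
Hypothesis p_sub : riemannian_submersion p.
Implicit Types (d e : chart R n M) (c b : chart R m B) (x : M).

(** * The submersion and horizontal vectors in arbitrary charts *)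

Definition pcoord c d (y : 'rV[R]_n) : 'rV[R]_m := to_coord c (p (of_coord d y)).

Definition pdom c d : set 'rV[R]_n :=
  [set y | chart_cod d y /\ chart_dom c (p (of_coord d y))].

Lemma p_cts : continuous p. Proof. by have [[]] := p_sub. Qed.

Lemma pdom_open c d : open (pdom c d).
Proof.
rewrite openE => y [yd yc].
have h1 : nbhs y (chart_cod d) by apply: open_nbhs_nbhs; split=> //; exact: chart_cod_open.
have h2 : nbhs y (of_coord d @^-1` (p @^-1` chart_dom c)).
  apply: (of_coord_cts yd); apply: p_cts; apply: open_nbhs_nbhs; split=> //.
  exact: chart_dom_open.
by apply: filterS (filterI h1 h2) => z [].
Qed.

Lemma pcoord_smooth c d : atlas c -> atlas d -> smooth_on (pdom c d) (pcoord c d).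
Proof. by move=> ac ad; have [[_ h] _ _ _] := p_sub; exact: h. Qed.

Lemma pdom_to_coord c d x : chart_dom d x -> chart_dom c (p x) ->
  pdom c d (to_coord d x).
Proof. by move=> xd xc; split; [exact: to_coord_cod|rewrite to_coordK]. Qed.

Lemma pcoord_to_coord c d x : chart_dom d x -> pcoord c d (to_coord d x) = to_coord c (p x).
Proof. by move=> xd; rewrite /pcoord to_coordK. Qed.

Lemma derive_pcoord_source c d e y u : atlas c -> atlas d -> atlas e ->
  pdom c d y -> overlap d e y ->
  'D_u (pcoord c d) y =
  'D_('D_u (transition d e) y) (pcoord c e) (transition d e y).
Proof.
move=> ac ad ae yc ode.
have [_ /(_ u)[de _]] := transition_C1 ad ae.
have D : is_derive y u (transition d e) ('D_u (transition d e) y).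
  by apply/derivableP; exact: de.
have yc' : pdom c e (transition d e y).
  have [h1 h2] := transition_overlap ode; split=> //.
  by rewrite of_coord_transition//; case: yc.
have [_ <-] := is_derive_comp_C1_mx (@pdom_open c e) (pcoord_smooth ac ae 1) yc' D.
apply: near_eq_derive.
have : nbhs y (overlap d e).
  by apply: open_nbhs_nbhs; split=> //; exact: overlap_open.
by apply: filterS => z hz; rewrite /pcoord of_coord_transition.
Qed.

Lemma derive_pcoord_target c b d y u : atlas c -> atlas b -> atlas d ->
  pdom c d y -> pdom b d y ->
  'D_u (pcoord b d) y =
  'D_('D_u (pcoord c d) y) (transition c b) (pcoord c d y).
Proof.
move=> ac ab ad yc yb.
have [_ /(_ u)[de _]] := pcoord_smooth ac ad 1.
have D : is_derive y u (pcoord c d) ('D_u (pcoord c d) y).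
  by apply/derivableP; exact: de.
have o : overlap c b (pcoord c d y).
  by apply: overlap_to_coord; [case: yc|case: yb].
have [_ <-] := is_derive_comp_C1_mx (@overlap_open _ _ _ c b) (transition_C1 ac ab) o D.
apply: near_eq_derive.
have : nbhs y (pdom c d).
  by apply: open_nbhs_nbhs; split=> //; exact: pdom_open.
by apply: filterS => z [h1 h2]; rewrite /pcoord transition_to_coord.
Qed.

Definition hor c d (y u : 'rV[R]_n) :=
  forall w, 'D_w (pcoord c d) y = 0 -> gform (metric d y) u w = 0.

Lemma hor_transition c d e y u : atlas c -> atlas d -> atlas e ->
  pdom c d y -> overlap d e y -> hor c d y u ->
  hor c e (transition d e y) ('D_u (transition d e) y).
Proof.
move=> ac ad ae yc ode hu w' hw'.
pose w := 'D_w' (transition e d) (transition d e y).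
have ew : 'D_w (transition d e) y = w' by exact: derive_transitionK.
rewrite -ew -(metric_compat ad ae ode); apply: hu.
by rewrite (derive_pcoord_source w ac ad ae yc ode) ew.
Qed.

Lemma hor_target c b d y u : atlas c -> atlas b -> atlas d ->
  pdom c d y -> pdom b d y -> hor c d y u -> hor b d y u.
Proof.
move=> ac ab ad yc yb hu w hw; apply: hu.
have := derive_pcoord_target w ab ac ad yb yc.
by rewrite hw derive0.
Qed.

(** The submersion hypothesis speaks of the charts selected by [chart_at] only; the derivatives of
    the transition maps, which are invertible, carry it to all charts. *)
Lemma pcoord_surj c d y (v : 'rV[R]_m) : atlas c -> atlas d -> pdom c d y ->
  exists u, 'D_u (pcoord c d) y = v.
Proof.
move=> ac ad yc; have [yd yp] := yc.
set x := of_coord d y in yp *.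
have xd : chart_dom d x by exact: of_coord_dom.
pose d0 := chart_at x; pose c0 := chart_at (p x).
have ad0 : atlas d0 by exact: chart_at_atlas.
have ac0 : atlas c0 by exact: chart_at_atlas.
have xd0 : chart_dom d0 x by exact: chart_at_dom.
have xc0 : chart_dom c0 (p x) by exact: chart_at_dom.
pose y0 := to_coord d0 x.
have yc0 : pdom c0 d0 y0 by exact: pdom_to_coord.
have ycc : pdom c d0 y0 by exact: pdom_to_coord.
have [_ _ /(_ x ('D_v (transition c c0) (to_coord c (p x))))[u0 hu0] _] := p_sub.
have o : overlap d0 d y0 by exact: overlap_to_coord.
have ey : transition d0 d y0 = y by rewrite /y0 transition_to_coord// /x of_coordK.
exists ('D_u0 (transition d0 d) y0).
rewrite -ey -(derive_pcoord_source u0 ac ad0 ad ycc o).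
rewrite (derive_pcoord_target u0 ac0 ac ad0 yc0 ycc).
have -> : 'D_u0 (pcoord c0 d0) y0 = 'D_v (transition c c0) (to_coord c (p x)).
  exact: hu0.
rewrite pcoord_to_coord//.
have o2 : overlap c0 c (to_coord c0 (p x)) by exact: overlap_to_coord.
have := derive_transitionK v ac0 ac o2.
by rewrite transition_to_coord.
Qed.

(** The transpose of the usual Jacobian matrix, since tangent vectors are rows. *)
Definition jac c d (y : 'rV[R]_n) : 'M[R]_(n, m) :=
  \matrix_(i, j) ('D_(delta_mx 0 i) (pcoord c d) y) 0 j.

Lemma derive_jac c d y u : atlas c -> atlas d -> pdom c d y ->
  'D_u (pcoord c d) y = u *m jac c d y.
Proof.
move=> ac ad yc.
rewrite (derive_sum_coord_mx u (@pdom_open c d) (pcoord_smooth ac ad 1) yc).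
apply/rowP => j; rewrite summxE mxE; apply: eq_bigr => i _.
by rewrite !mxE.
Qed.

Lemma unitmx_of_ker (k : nat) (A : 'M[R]_k) :
  (forall u : 'rV[R]_k, u *m A = 0 -> u = 0) -> A \in unitmx.
Proof.
move=> h; rewrite -row_free_unit -kermx_eq0; apply/eqP/row_matrixP => i.
by rewrite row0; apply: h; rewrite -row_mul mulmx_ker row0.
Qed.

Lemma gform_eq0 d y u : atlas d -> chart_cod d y ->
  gform (metric d y) u u = 0 -> u = 0.
Proof.
move=> ad yd h; apply/eqP/negP => /negP u0.
by have := metric_pos ad yd u0; rewrite h ltxx.
Qed.

Lemma metric_unit d y : atlas d -> chart_cod d y -> metric d y \in unitmx.
Proof.
move=> ad yd; apply: unitmx_of_ker => u hu.
by apply: (gform_eq0 ad yd); rewrite /gform hu mul0mx mxE.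
Qed.

(** The Gram matrix, for the dual metric of [M], of the coordinate covectors of [B] pulled back by
    [p]. *)
Definition Amat c d y : 'M[R]_m := (jac c d y)^T *m invmx (metric d y) *m jac c d y.

(* In the chart [d], the horizontal lift of the coordinate vector [v] is
   [v *m Hmat c d y]: horizontal vectors are the [u] such that
   [u *m metric d y = l *m (jac c d y)^T] for some [l]. *)
Definition Hmat c d y : 'M[R]_(m, n) :=
  invmx (Amat c d y) *m (jac c d y)^T *m invmx (metric d y).

(** If [l] is in the kernel, the metric dual [a] of the covector pulled back from [l] is vertical
    and satisfies [gform (metric d y) a a = 0]; so it vanishes, and surjectivity of the differential
    gives [l = 0]. *)
Lemma Amat_unit c d y : atlas c -> atlas d -> pdom c d y -> Amat c d y \in unitmx.
Proof.
move=> ac ad yc; have yd : chart_cod d y by case: yc.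
apply: unitmx_of_ker => l hl.
pose a := l *m (jac c d y)^T *m invmx (metric d y).
have gu := metric_unit ad yd.
have ga : a *m metric d y = l *m (jac c d y)^T by rewrite /a mulmxKV.
have aJ : a *m jac c d y = 0 by rewrite -hl /a /Amat !mulmxA.
have a0 : a = 0.
  apply: (gform_eq0 ad yd); rewrite /gform ga -mulmxA -trmx_mul aJ.
  by rewrite trmx0 mulmx0 mxE.
have lJ : l *m (jac c d y)^T = 0 by rewrite -ga a0 mul0mx.
apply/rowP => j; rewrite [RHS]mxE.
have [u hu] := pcoord_surj (delta_mx 0 j) ac ad yc.
rewrite derive_jac// in hu.
have : l *m (delta_mx 0 j : 'rV[R]_m)^T = 0.
  by rewrite -hu trmx_mul mulmxA lJ mul0mx.
move/(congr1 (fun A : 'M[R]_1 => A 0 0)); rewrite !mxE => <-.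
rewrite (bigD1 j)//= !mxE !eqxx mulr1 big1 ?addr0// => i ij.
by rewrite !mxE eqxx (negbTE ij) mulr0.
Qed.

Lemma Hmat_lift c d y (v : 'rV[R]_m) : atlas c -> atlas d -> pdom c d y ->
  'D_(v *m Hmat c d y) (pcoord c d) y = v.
Proof.
move=> ac ad yc; rewrite derive_jac//.
have -> : v *m Hmat c d y *m jac c d y = v *m (invmx (Amat c d y) *m Amat c d y).
  by rewrite /Hmat /Amat !mulmxA.
by rewrite mulVmx ?mulmx1//; exact: Amat_unit.
Qed.

Lemma Hmat_hor c d y (v : 'rV[R]_m) : atlas c -> atlas d -> pdom c d y ->
  hor c d y (v *m Hmat c d y).
Proof.
move=> ac ad yc w; rewrite derive_jac// => hw; have yd : chart_cod d y by case: yc.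
rewrite /gform /Hmat !mulmxA mulmxKV; last exact: metric_unit.
by rewrite -mulmxA -trmx_mul hw trmx0 mulmx0 mxE.
Qed.

Lemma gformBl (G : 'M[R]_n) (u v w : 'rV[R]_n) :
  gform G (u - v) w = gform G u w - gform G v w.
Proof. by rewrite /gform !mulmxBl !mxE. Qed.

Lemma hor_inj c d y u1 u2 : atlas c -> atlas d -> pdom c d y ->
  hor c d y u1 -> hor c d y u2 ->
  'D_u1 (pcoord c d) y = 'D_u2 (pcoord c d) y -> u1 = u2.
Proof.
move=> ac ad yc h1 h2; rewrite !derive_jac// => e12.
have e0 : (u1 - u2) *m jac c d y = 0 by rewrite mulmxBl e12 subrr.
have yd : chart_cod d y by case: yc.
apply/eqP; rewrite -subr_eq0; apply/eqP; apply: (gform_eq0 ad yd).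
by rewrite gformBl h1 ?h2 ?subrr// derive_jac.
Qed.

(** Being horizontal and projecting to [v] do not depend on the chart, and together they determine a
    vector: the difference of two candidates is both horizontal and vertical. *)
Lemma Hmat_transition c d e y (v : 'rV[R]_m) : atlas c -> atlas d -> atlas e ->
  pdom c d y -> overlap d e y ->
  'D_(v *m Hmat c d y) (transition d e) y = v *m Hmat c e (transition d e y).
Proof.
move=> ac ad ae yc ode.
have yc' : pdom c e (transition d e y).
  have [h1 h2] := transition_overlap ode; split=> //.
  by rewrite of_coord_transition//; case: yc.
apply: (hor_inj ac ae yc').
- by apply: hor_transition => //; exact: Hmat_hor.
- exact: Hmat_hor.
- by rewrite -derive_pcoord_source// !Hmat_lift.
Qed.

Lemma Hmat_smooth c d : atlas c -> atlas d -> smooth_on (pdom c d) (Hmat c d).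
Proof.
move=> ac ad k; have oD := @pdom_open c d.
have gs : Ck_on k (pdom c d) (metric d).
  by apply: Ck_on_sub (metric_smooth ad k) => y [].
have Js : Ck_on k (pdom c d) (jac c d).
  apply/Ck_on_mx => // i j; rewrite /jac; under eq_fun do rewrite mxE.
  have [_ /(_ (delta_mx 0 i)) [_ h]] := pcoord_smooth ac ad k.+1.
  by have /Ck_on_mx := h; exact.
have gi : Ck_on k (pdom c d) (fun y => invmx (metric d y)).
  by apply: Ck_on_invmx => // y [yd _]; exact: metric_unit.
have JT := Ck_on_trmx oD Js.
apply: Ck_on_mulmx => //; apply: Ck_on_mulmx => //.
apply: Ck_on_invmx => //; first by move=> y; exact: Amat_unit.
by apply: Ck_on_mulmx => //; exact: Ck_on_mulmx.
Qed.

Lemma hor_horizontal c x u : atlas c -> chart_dom c (p x) ->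
  hor c (chart_at x) (coord_at x) u -> horizontal p x u.
Proof.
move=> ac xc hu w hw.
have ad0 : atlas (chart_at x) by exact: chart_at_atlas.
have xd0 : chart_dom (chart_at x) x by exact: chart_at_dom.
apply: (@hor_target c (chart_at (p x)) (chart_at x) (coord_at x) u) => //.
- exact: chart_at_atlas.
- exact: pdom_to_coord.
- by apply: pdom_to_coord => //; exact: chart_at_dom.
Qed.

(** The right side involves only the base point [p x]. Hence the speed of a lift is bounded before
    the lift is known to exist. *)
Lemma inner_Hmat c x (v : 'rV[R]_m) : atlas c -> chart_dom c (p x) ->
  let u := v *m Hmat c (chart_at x) (coord_at x) in
  inner x u u = gform (metric c (to_coord c (p x))) v v.
Proof.
move=> ac xc u.
have ad0 : atlas (chart_at x) by exact: chart_at_atlas.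
have xd0 : chart_dom (chart_at x) x by exact: chart_at_dom.
have ac0 : atlas (chart_at (p x)) by exact: chart_at_atlas.
have xc0 : chart_dom (chart_at (p x)) (p x) by exact: chart_at_dom.
have yc : pdom c (chart_at x) (coord_at x) by exact: pdom_to_coord.
have yc0 : pdom (chart_at (p x)) (chart_at x) (coord_at x) by exact: pdom_to_coord.
have hu : horizontal p x u by apply: (hor_horizontal ac xc); exact: Hmat_hor.
have [_ _ _ iso] := p_sub.
rewrite -(iso x u u hu hu).
have -> : differential p x u = 'D_v (transition c (chart_at (p x))) (to_coord c (p x)).
  transitivity ('D_u (pcoord (chart_at (p x)) (chart_at x)) (coord_at x)); first by [].
  rewrite (derive_pcoord_target u ac ac0 ad0 yc yc0) Hmat_lift//.
  by rewrite pcoord_to_coord.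
rewrite (metric_compat ac ac0 (overlap_to_coord xc xc0)).
by rewrite transition_to_coord.
Qed.

(** The equation of the horizontal lift with constant coordinate velocity [v]. It is asked in every
    chart of [M] around [g t], so that solutions may leave a chart; by [sol_of_chart] one chart
    suffices. It is a condition at one time, so that solutions can be restricted and glued. *)
Definition sol c (v : 'rV[R]_m) (g : R -> M) (t : R) : Prop :=
  [/\ chart_dom c (p (g t)), {for t, continuous g} &
   forall d, atlas d -> chart_dom d (g t) ->
     is_derive t 1 (fun s => to_coord d (g s)) (v *m Hmat c d (to_coord d (g t)))].

Lemma near_chart_dom d (g : R -> M) t : {for t, continuous g} -> chart_dom d (g t) ->
  \forall s \near t, chart_dom d (g s).
Proof.
by move=> gc gd; apply: gc; apply: open_nbhs_nbhs; split=> //; exact: chart_dom_open.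
Qed.

Lemma sol_of_chart c d (v : 'rV[R]_m) (g : R -> M) t : atlas c -> atlas d ->
  chart_dom c (p (g t)) -> {for t, continuous g} -> chart_dom d (g t) ->
  is_derive t 1 (fun s => to_coord d (g s)) (v *m Hmat c d (to_coord d (g t))) ->
  sol c v g t.
Proof.
move=> ac ad gcd gc gd D; split=> // e ae ge.
have o : overlap d e (to_coord d (g t)) by exact: overlap_to_coord.
have := is_derive_comp_C1_mx (@overlap_open _ _ _ d e) (transition_C1 ad ae) o D.
rewrite Hmat_transition//; last exact: pdom_to_coord.
rewrite transition_to_coord//; apply: near_eq_is_derive.
apply: filterS (near_chart_dom gc gd) => s hs.
by rewrite transition_to_coord.
Qed.

Lemma sol_near_eq c (v : 'rV[R]_m) (g h : R -> M) t :
  (\forall s \near t, g s = h s) -> sol c v g t -> sol c v h t.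
Proof.
move=> gh [gcd gc gD]; have e := nbhs_singleton gh; split.
- by rewrite -e.
- rewrite /prop_for /continuous_at -e; apply: cvg_trans gc; exact: near_eq_cvg.
- move=> d ad; rewrite -e => gd; apply: near_eq_is_derive (gD d ad gd).
  by apply: filterS gh => s ->.
Qed.

Lemma is_derive_dir (W : normedModType R) (f : R -> W) (f' : W) (t w : R) :
  is_derive t 1 f f' -> is_derive t w f (w *: f').
Proof.
move=> [fd <-]; have df : differentiable f t by apply/derivable1_diffP.
apply: DeriveDef; first exact: diff_derivable.
have ew : w *: (1 : R) = w by rewrite [_ *: _]mulr1.
rewrite !deriveE// -[X in 'd f t X = _]ew.
exact: linearZ.
Qed.

Lemma is_derive_affine (W : normedModType R) (f : R -> W) (f' : W) (a b t : R) :
  is_derive (a + t * b) 1 f f' -> is_derive t 1 (fun s => f (a + s * b)) (b *: f').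
Proof.
move=> /(@is_derive_dir _ _ _ _ b) [fd fE].
by have := @is_derive_line R R W f a b t fd; rewrite fE.
Qed.

Lemma sol_affine c (v : 'rV[R]_m) (g : R -> M) (a b t : R) :
  sol c v g (a + t * b) -> sol c (b *: v) (fun s => g (a + s * b)) t.
Proof.
move=> [gcd gc gD]; split=> //.
- apply: continuous_comp; last exact: gc.
  by apply: cvgD; [exact: cvg_cst|apply: cvgMl; exact: cvg_id].
- move=> d ad gd; rewrite -scalemxAl.
  exact: (@is_derive_affine _ (fun s => to_coord d (g s))) (gD d ad gd).
Qed.

Lemma sol_pcoord c (v : 'rV[R]_m) (g : R -> M) t : atlas c -> sol c v g t ->
  is_derive t 1 (fun s => to_coord c (p (g s))) v.
Proof.
move=> ac [gcd gc gD]; pose d := chart_at (g t).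
have ad : atlas d by exact: chart_at_atlas.
have gd : chart_dom d (g t) by exact: chart_at_dom.
have yc := pdom_to_coord gd gcd.
have := is_derive_comp_C1_mx (@pdom_open c d) (pcoord_smooth ac ad 1) yc (gD d ad gd).
rewrite Hmat_lift//; apply: near_eq_is_derive.
apply: filterS (near_chart_dom gc gd) => s hs.
by rewrite pcoord_to_coord.
Qed.

Lemma sol_line c (v : 'rV[R]_m) (g : R -> M) (a b : R) : atlas c ->
  (forall t, a < t < b -> sol c v g t) ->
  forall s t, a < s < b -> a < t < b ->
  to_coord c (p (g t)) = to_coord c (p (g s)) + (t - s) *: v.
Proof.
move=> ac gs s t sab tab.
pose f u := to_coord c (p (g u)) - u *: v.
have : `|f t - f s| <= 0 * `|t - s|.
  apply: (@derive_norm_le R 1 m f (fun=> v - v) a b) => // u uab.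
    apply: is_deriveB; first by apply: sol_pcoord => //; exact: gs.
    exact: is_derive_scalel.
  by rewrite subrr normr0.
rewrite mul0r normr_le0 subr_eq0 /f => /eqP h.
by rewrite scalerBl addrCA -h addrC subrK.
Qed.

(** Bootstrap: by the equation, the derivative of a curve of class C^k is a smooth function of that
    curve, hence of class C^k as well. *)
Lemma sol_smooth c (v : 'rV[R]_m) (g : R -> M) (a b : R) : atlas c ->
  (forall t, a < t < b -> sol c v g t) -> smooth_curve `]a, b[%classic g.
Proof.
move=> ac gs; split=> [t /=|d ad].
  by rewrite in_itv/= => /gs[].
set U := [set t : R | _].
have Us t : U t -> sol c v g t by move=> []; rewrite /= in_itv/= => /gs.
have oU : open U.
  rewrite openE => t Ut; have [_ gc _] := Us t Ut; case: (Ut) => tab gd.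
  have h1 : nbhs t `]a, b[%classic by apply: open_nbhs_nbhs; split=> //; exact: interval_open.
  by apply: filterS (filterI h1 (near_chart_dom gc gd)) => s [].
have D t w : U t -> is_derive t w (fun s => to_coord d (g s))
    (w *: (v *m Hmat c d (to_coord d (g t)))).
  move=> Ut; have [_ _ /(_ d ad)] := Us t Ut; case: (Ut) => _ gd /(_ gd).
  exact: is_derive_dir.
have C0 t : U t -> {for t, continuous (fun s => to_coord d (g s))}.
  move=> Ut; have [_ gc _] := Us t Ut; case: (Ut) => _ gd.
  by apply: continuous_comp => //; exact: to_coord_cts.
elim=> [|k IH]; split=> // w; split=> [t Ut|]; first by have [] := D t w Ut.
suff h : Ck_on k U (fun t => w *: (v *m Hmat c d (to_coord d (g t)))).
  by apply: Ck_on_eq h => // t Ut; have [_ ->] := D t w Ut.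
have hH : Ck_on k U (fun t => Hmat c d (to_coord d (g t))).
  apply: (Ck_on_comp_mx oU (@pdom_open c d)) (Hmat_smooth ac ad k) IH.
  by move=> t Ut; have [gcd _ _] := Us t Ut; case: (Ut) => _ gd; exact: pdom_to_coord.
have hv := Ck_on_mulmx oU (Ck_on_cst U v k) hH.
have := Ck_on_mulmx oU (Ck_on_cst U (w%:M : 'M[R]_1) k) hv.
by apply: Ck_on_eq => // t Ut; rewrite mul_scalar_mx.
Qed.

Lemma sol_velocity c (v : 'rV[R]_m) (g : R -> M) t : sol c v g t ->
  velocity g t = v *m Hmat c (chart_at (g t)) (coord_at (g t)).
Proof.
move=> [_ _ /(_ (chart_at (g t)) (chart_at_atlas _) (chart_at_dom _))].
by case.
Qed.

Lemma sol_horizontal c (v : 'rV[R]_m) (g : R -> M) t : atlas c -> sol c v g t ->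
  horizontal p (g t) (velocity g t).
Proof.
move=> ac gs; rewrite (sol_velocity gs); case: gs => gcd _ _.
apply: (hor_horizontal ac gcd); apply: Hmat_hor => //; first exact: chart_at_atlas.
by apply: pdom_to_coord => //; exact: chart_at_dom.
Qed.

Lemma sol_speed c (v : 'rV[R]_m) (g : R -> M) t : atlas c -> sol c v g t ->
  inner (g t) (velocity g t) (velocity g t) =
  gform (metric c (to_coord c (p (g t)))) v v.
Proof.
by move=> ac gs; rewrite (sol_velocity gs) inner_Hmat//; case: gs.
Qed.

Lemma sol_dual_leaf c (v : 'rV[R]_m) (g : R -> M) (e : R) : atlas c -> 0 < e ->
  (forall t : R, - e < t < 1 + e -> sol c v g t) -> dual_leaf p (g 0) (g 1).
Proof.
move=> ac e0 gs; exists 0, 1, g; split=> //; exists [:: 1].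
  split; first exact: itv_partition1.
  case=> [_|//]; exists `]- e, 1 + e[%classic, g; split => //.
  - by move=> t; rewrite /= !in_itv/= => /andP[t0 t1]; apply/andP; split; lra.
  - exact: sol_smooth gs.
move=> t /andP[t0 t1] _; apply: (sol_horizontal ac); apply: gs.
by apply/andP; split; lra.
Qed.

(** * Local flow and uniqueness of lifts *)

Lemma near_to_coord d x (r : R) : chart_dom d x -> 0 < r ->
  \forall z \near x, chart_dom d z /\ `|to_coord d z - to_coord d x| < r.
Proof.
move=> xd r0; apply: filterI.
  by apply: open_nbhs_nbhs; split=> //; exact: chart_dom_open.
have /cvgrPdist_lt /(_ r r0) := to_coord_cts xd.
by apply: filterS => z; rewrite distrC.
Qed.

(** The existence time [e] is common to all starting points near [x0] and all velocities of norm at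
    most [Rv]. The last clause compares any two solutions that stay in [N]: with [v1 = v2] it gives
    uniqueness, in general continuous dependence. *)
Lemma local_flow c (x0 : M) (Rv : R) : atlas c -> chart_dom c (p x0) -> 0 < Rv ->
  exists (N : set M) (e K : R),
  [/\ 0 < e, (\forall x \near x0, N x), N `<=` chart_dom (chart_at x0),
   \forall x \near x0, forall v : 'rV[R]_m, `|v| <= Rv ->
     exists g : R -> M, g 0 = x /\ forall t, `|t| < e -> N (g t) /\ sol c v g t &
   forall (v1 v2 : 'rV[R]_m) (g1 g2 : R -> M) (a b : R),
     `|v1| <= Rv -> `|v2| <= Rv -> b - a <= 2 * e ->
     (forall t, a < t < b -> N (g1 t) /\ sol c v1 g1 t) ->
     (forall t, a < t < b -> N (g2 t) /\ sol c v2 g2 t) ->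
     forall s t, a < s < b -> a < t < b ->
     `|to_coord (chart_at x0) (g1 t) - to_coord (chart_at x0) (g2 t)| <=
      2 * (`|to_coord (chart_at x0) (g1 s) - to_coord (chart_at x0) (g2 s)| +
           (b - a) * (K * `|v1 - v2|))].
Proof.
move=> ac xc Rv0; set d := chart_at x0.
have ad : atlas d by exact: chart_at_atlas.
have xd : chart_dom d x0 by exact: chart_at_dom.
pose y0 := to_coord d x0.
have [r [K [r0 K0 rU HK HL]]] := C1_bounded_lipschitz (@pdom_open c d)
  (Hmat_smooth ac ad 1) (pdom_to_coord xd xc).
pose K1 := m%:R * Rv * K + 1.
have K1p : 0 < K1 by rewrite ltr_wpDl// !mulr_ge0// ltW.
have FK (v : 'rV[R]_m) y : `|v| <= Rv -> `|y - y0| <= r -> `|v *m Hmat c d y| <= K1.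
  move=> vR yr; apply: le_trans (mulmx_norm_le _ _) _.
  apply: (@le_trans _ _ (m%:R * Rv * K)); last by rewrite /K1 lerDl.
  apply: ler_pM => //; last exact: HK.
  by apply: ler_wpM2l.
have FL (v : 'rV[R]_m) y z : `|v| <= Rv -> `|y - y0| <= r -> `|z - y0| <= r ->
    `|v *m Hmat c d y - v *m Hmat c d z| <= K1 * `|y - z|.
  move=> vR yr zr; rewrite -mulmxBr; apply: le_trans (mulmx_norm_le _ _) _.
  apply: (@le_trans _ _ (m%:R * Rv * (K * `|y - z|))).
    apply: ler_pM => //; last exact: HL.
    by apply: ler_wpM2l.
  by rewrite mulrA; apply: ler_wpM2r => //; rewrite /K1 lerDl.
(* The three bounds give, in order: [e <= 2^-1] for [picard]; [K1 * (2 * e) <= 2^-1] for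
   [derive_gronwall] on an interval of length up to [2 * e]; and the confinement condition of
   [picard] for the radius [r / 2]. *)
pose e := Num.min 2^-1 (Num.min ((4 * K1)^-1) (r / (4 * K1))).
have K4 : 0 < 4 * K1 by rewrite mulr_gt0.
have e0 : 0 < e by rewrite !lt_min invr_gt0 ltr0n /= invr_gt0 K4 divr_gt0.
have e1 : e <= 2^-1 by rewrite ge_min lexx.
have e2 : K1 * e <= 4^-1.
  have : e <= (4 * K1)^-1 by rewrite !ge_min lexx orbT.
  by rewrite -(ler_pM2l K1p) invfM mulrCA divff ?mulr1// gt_eqF.
have e3 : K1 * e <= r / 4.
  have : e <= r / (4 * K1) by rewrite !ge_min lexx !orbT.
  rewrite -(ler_pM2l K1p) => h; apply: le_trans h _.
  suff -> : K1 * (r / (4 * K1)) = r / 4 by [].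
  by field; rewrite gt_eqF.
pose N := [set x : M | chart_dom d x /\ `|to_coord d x - y0| < r].
exists N, e, (m%:R * K); split => //.
- exact: near_to_coord.
- by move=> x [].
- have r4 : 0 < r / 4 by rewrite divr_gt0.
  apply: filterS (near_to_coord xd r4) => x [xd' xr] v vR.
  have r2 : 0 < r / 2 by rewrite divr_gt0.
  have rr : r / 2 <= r by move: r0; lra.
  (* The radius [r / 2] instead of [r] keeps the solution strictly inside [N]. *)
  have [|||||y [yz yD]] := @picard R n (fun y => v *m Hmat c d y) y0 (r / 2) K1 e
      r2 K1p _ _ e0 e1 _ _ (to_coord d x) _.
  + by move=> y yr; apply: FK => //; exact: le_trans rr.
  + by move=> y z yr zr; apply: FL => //; [exact: le_trans rr|exact: le_trans rr].
  + by apply: le_trans e2 _; lra.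
  + by move: e3; lra.
  + by apply: ltW; move: xr; lra.
  have yU t : `|t| < e -> pdom c d (y t).
    by move=> te; have [h _] := yD t te; apply: rU; exact: le_trans rr.
  exists (fun t => of_coord d (y t)); split; first by rewrite yz to_coordK.
  move=> t te; have [yr yD'] := yD t te; have [yd yc] := yU t te.
  have yct : {for t, continuous y}.
    by apply: differentiable_continuous; apply/derivable1_diffP; case: yD'.
  split; first by split; [exact: of_coord_dom|rewrite of_coordK//; move: yr r0; lra].
  apply: (sol_of_chart ac ad) => //; last 2 first.
  + exact: of_coord_dom.
  + rewrite of_coordK//; apply: near_eq_is_derive yD'.
    have : \forall s \near t, `|s| < e.
      apply/near_distP; exists (e - `|t|); first by rewrite subr_gt0.
      move=> s; rewrite distrC => st; rewrite -[s](subrK t).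
      by apply: le_lt_trans (ler_normD _ _) _; rewrite -ltrBrDr.
    by apply: filterS => s /yU[h _]; rewrite of_coordK.
  + by apply: continuous_comp => //; exact: of_coord_cts.
- move=> v1 v2 g1 g2 a b v1R v2R ba h1 h2 s t sab tab.
  have ab0 : 0 <= b - a by case/andP: sab; lra.
  have b1 u : a < u < b -> `|to_coord d (g1 u) - y0| <= r.
    by move=> /h1[[_ h] _]; exact: ltW.
  have b2 u : a < u < b -> `|to_coord d (g2 u) - y0| <= r.
    by move=> /h2[[_ h] _]; exact: ltW.
  apply: (@derive_gronwall R 1 n (fun t => to_coord d (g1 t))
    (fun t => to_coord d (g2 t)) (fun t => v1 *m Hmat c d (to_coord d (g1 t)))
    (fun t => v2 *m Hmat c d (to_coord d (g2 t))) a b K1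
    (m%:R * K * `|v1 - v2|) (2 * r) _ _ _ _ _ _ _ s t) => //.
  + exact: ltW.
  + by rewrite !mulr_ge0// ltW.
  + have : K1 * (b - a) <= K1 * (2 * e) by apply: ler_wpM2l => //; exact: ltW.
    by move: e2; lra.
  + by move=> u /h1[[gd _] [_ _ /(_ d ad gd)]].
  + by move=> u /h2[[gd _] [_ _ /(_ d ad gd)]].
  + move=> u uab; set y1 := to_coord d (g1 u); set y2 := to_coord d (g2 u).
    have -> : v1 *m Hmat c d y1 - v2 *m Hmat c d y2 =
       (v1 *m Hmat c d y1 - v1 *m Hmat c d y2) + (v1 - v2) *m Hmat c d y2.
      by rewrite mulmxBl addrA subrK.
    apply: le_trans (ler_normD _ _) _; apply: lerD.
      by apply: FL => //; [exact: b1|exact: b2].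
    apply: le_trans (mulmx_norm_le _ _) _; rewrite mulrAC.
    by apply: ler_wpM2r => //; apply: ler_wpM2l => //; apply: HK; exact: b2.
  + move=> u uab; rewrite -(subrKA y0) (le_trans (ler_normD _ _))//.
    rewrite [`|y0 - _|]distrC mulr2n mulrDl mul1r; apply: lerD; [exact: b1|exact: b2].
Qed.

Lemma interval_propagation_oo (a b : R) (P : R -> Prop) :
  (forall t0, a < t0 < b -> exists2 e : R, 0 < e & forall s t, a < s < b ->
     a < t < b -> `|s - t0| < e -> `|t - t0| < e -> P s -> P t) ->
  forall s t, a < s < b -> a < t < b -> P s -> P t.
Proof.
move=> loc s t /andP[as_ sb] /andP[at_ tb] Ps; have [st|ts] := leP s t.
  apply: (@interval_propagation R s t P Ps); last by rewrite st lexx.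
  move=> t0 /andP[st0 t0t].
  have [|e e0 he] := loc t0; first by apply/andP; split; lra.
  exists e => // u v /andP[u1 u2] /andP[v1 v2].
  by apply: he; apply/andP; split; lra.
(* Backwards in time: the forward case for the reflected predicate. *)
have := @interval_propagation R (- s) (- t) (fun u => P (- u)).
rewrite opprK => /(_ Ps) h; rewrite -[t]opprK; apply: h; last by apply/andP; split; lra.
move=> t0 /andP[st0 t0t].
have [|e e0 he] := loc (- t0); first by apply/andP; split; lra.
exists e => // u v /andP[u1 u2] /andP[v1 v2] ue ve.
apply: he; [by apply/andP; split; lra|by apply/andP; split; lra| |].
  by rewrite -opprD normrN.
by rewrite -opprD normrN.
Qed.

Lemma hausdorff_separate (T : topologicalType) (x y : T) : hausdorff_space T ->
  x <> y -> exists A C, [/\ nbhs x A, nbhs y C & forall z, A z -> C z -> False].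
Proof.
move=> hT xy; apply: contrapT => h; apply: xy; apply: hT => A C xA yC.
apply: contrapT => h'; apply: h; exists A, C; split=> // z Az Cz.
by apply: h'; exists z.
Qed.

Lemma near_interval (a b t0 : R) : a < t0 < b -> exists2 e : R, 0 < e &
  forall t, `|t - t0| < e -> a < t < b.
Proof.
move=> /andP[h1 h2]; exists (Num.min (t0 - a) (b - t0)).
  by rewrite lt_min !subr_gt0 h1 h2.
by move=> t; rewrite lt_min !ltr_norml => /andP[/andP[? ?] /andP[? ?]]; apply/andP; split; lra.
Qed.

(** If the curves differ at [t0], the Hausdorff property makes them differ at all nearby times, so
    nothing has to be propagated. If they agree at [t0], both stay in the same neighbourhood [N]
    near [t0], and the estimate of [local_flow] with equal velocities applies. *)
Lemma sol_unique c (v : 'rV[R]_m) (g1 g2 : R -> M) (a b : R) : atlas c ->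
  (forall t, a < t < b -> sol c v g1 t) -> (forall t, a < t < b -> sol c v g2 t) ->
  forall s t, a < s < b -> a < t < b -> g1 s = g2 s -> g1 t = g2 t.
Proof.
move=> ac h1 h2; apply: interval_propagation_oo => t0 t0ab.
have [gcd1 gc1 _] := h1 t0 t0ab; have [_ gc2 _] := h2 t0 t0ab.
have [e12|e12] := pselect (g1 t0 = g2 t0); last first.
  have [A [C [hA hC AC]]] := hausdorff_separate (@carrier_hausdorff _ _ M) e12.
  have : \forall s \near t0, A (g1 s) /\ C (g2 s).
    by apply: filterI; [exact: gc1|exact: gc2].
  move=> /near_distP[d d0 hd].
  exists d => // s t sab tab sd _ es; exfalso.
  rewrite distrC in sd; have [As Cs] := hd s sd.
  by apply: AC Cs; rewrite -es.
have Rv0 : 0 < `|v| + 1 by rewrite ltr_wpDl.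
have [N [e [K [e0 xN Nd _ D]]]] := local_flow ac gcd1 Rv0.
have xN2 := xN; rewrite e12 in xN2.
have : \forall s \near t0, N (g1 s) /\ N (g2 s).
  by apply: filterI; [exact: gc1|exact: gc2].
move=> /near_distP[d d0 hd].
have [f f0 hf] := near_interval t0ab.
pose k := Num.min e (Num.min d f).
have k0 : 0 < k by rewrite !lt_min e0 d0 f0.
have [ke kd kf] : [/\ k <= e, k <= d & k <= f] by rewrite !ge_min !lexx !orbT.
exists k => // s t _ _; rewrite !ltr_distl => sk tk est.
have vR : `|v| <= `|v| + 1 by rewrite lerDl.
have hk u : t0 - k < u < t0 + k -> N (g1 u) /\ N (g2 u) /\ a < u < b.
  move=> /andP[u1 u2]; have ud : `|t0 - u| < d by rewrite ltr_norml; apply/andP; split; lra.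
  have [n1 n2] := hd u ud; split=> //; split=> //.
  by apply: hf; rewrite ltr_norml; apply/andP; split; lra.
have h : `|to_coord (chart_at (g1 t0)) (g1 t) - to_coord (chart_at (g1 t0)) (g2 t)| <= 0.
  have -> : 0 = 2 * (`|to_coord (chart_at (g1 t0)) (g1 s) -
     to_coord (chart_at (g1 t0)) (g2 s)| + (t0 + k - (t0 - k)) * (K * `|v - v|)) :> R.
    by rewrite est !subrr !normr0 !mulr0 addr0 mulr0.
  apply: D => //.
  - by move: ke; lra.
  - by move=> u /hk[n1 [_ uab]]; split=> //; exact: h1.
  - by move=> u /hk[_ [n2 uab]]; split=> //; exact: h2.
move: h; rewrite normr_le0 subr_eq0 => /eqP h.
rewrite -(to_coordK (Nd _ (hk t tk).1)) h to_coordK//.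
exact: Nd (hk t tk).2.1.
Qed.

(** * Length of lifts and their existence up to time 1 *)

Lemma cvg_mulmx (T : Type) (F : set_system T) (FF : Filter F) (k l q : nat)
    (f : T -> 'M[R]_(k, l)) (g : T -> 'M[R]_(l, q)) (A : 'M[R]_(k, l)) (C : 'M[R]_(l, q)) :
  f @ F --> A -> g @ F --> C -> f x *m g x @[x --> F] --> A *m C.
Proof.
move=> fA gC; apply: cvg_mx => i j; rewrite mxE; under eq_fun do rewrite mxE.
by apply: cvg_bigsum => h; apply: cvgM; exact: cvg_mx_entry.
Qed.

Lemma speed_continuous c (q v : 'rV[R]_m) (t : R) : atlas c ->
  chart_cod c (q + t *: v) ->
  {for t, continuous (fun t : R => gform (metric c (q + t *: v)) v v)}.
Proof.
move=> ac tc; have [mc _] := metric_smooth ac 0.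
have c1 : {for t, continuous (fun t : R => q + t *: v)}.
  by apply: cvgD; [exact: cvg_cst|apply: cvgZr_tmp; exact: cvg_id].
have c2 : {for t, continuous (fun t : R => metric c (q + t *: v))}.
  by apply: continuous_comp c1 _; exact: mc.
rewrite /prop_for /continuous_at /gform; apply: cvg_mx_entry.
by apply: cvg_mulmx; [apply: cvg_mulmx; [exact: cvg_cst|exact: c2]|exact: cvg_cst].
Qed.

Lemma sol_dist c (q v : 'rV[R]_m) (g : R -> M) (a b a' b' C : R) : atlas c ->
  a' < a -> a < b -> b < b' -> 0 <= C ->
  (forall t, a' < t < b' -> sol c v g t) ->
  (forall t, a <= t <= b -> to_coord c (p (g t)) = q + t *: v) ->
  (forall t, a <= t <= b -> gform (metric c (q + t *: v)) v v <= C ^+ 2) ->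
  (riemannian_dist (g a) (g b) <= (C * (b - a))%:E)%E.
Proof.
move=> ac a'a ab bb' C0 gs gq gC.
have in_ t : a <= t <= b -> a' < t < b' by case/andP=> h1 h2; apply/andP; split; lra.
apply: ge_ereal_inf; exists (curve_length a b g).
  exists a, b, g; split=> //; exists [:: b].
  split; first exact: itv_partition1.
  case=> [_|//]; exists `]a', b'[%classic, g; split => //.
  - exact: sol_smooth gs.
have mI : measurable (`[a, b]%classic : set R) by exact: measurable_itv.
pose h (t : R) : R := Num.sqrt (gform (metric c (q + t *: v)) v v).
have E t : a <= t <= b ->
    Num.sqrt (inner (g t) (velocity g t) (velocity g t)) = h t.
  by move=> tab; rewrite (sol_speed ac (gs t (in_ t tab))) gq.
apply: (@le_trans _ _ (\int[lebesgue_measure]_(t in `[a, b]) (h t)%:E)%E).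
  have -> // : curve_length a b g = (\int[lebesgue_measure]_(t in `[a, b]) (h t)%:E)%E.
  by apply: eq_integral => t; rewrite inE/= in_itv/= => /E ->.
have hC t : a <= t <= b -> h t <= C.
  by move=> tab; rewrite -(ger0_norm C0) -sqrtr_sqr ler_wsqrtr//; exact: gC.
have mh : measurable_fun (`[a, b]%classic : set R) h.
  apply: measurable_realfun.subspace_continuous_measurable_fun => //.
  apply: continuous_in_subspaceT => t; rewrite inE/= in_itv/= => tab.
  apply: continuous_comp; last exact: sqrt_continuous.
  apply: speed_continuous => //; rewrite -gq//; apply: to_coord_cod.
  by have [] := gs t (in_ t tab).
apply: (@le_trans _ _ (\int[lebesgue_measure]_(t in `[a, b]) cst C%:E t)%E).
  apply: ge0_le_integral => //.
    by move=> t _; rewrite lee_fin sqrtr_ge0.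
  exact/measurable_realfun.measurable_EFinP.
have I := @integral_cst _ _ R lebesgue_measure (`[a, b]%classic : set R) mI C%:E.
apply: (@le_trans _ _ (C%:E * lebesgue_measure (`[a, b]%classic : set R))%E).
  by rewrite -I.
by rewrite lebesgue_measure_itv/= lte_fin ab -EFinB -EFinM.
Qed.

Lemma riemannian_distxx (x : M) : (riemannian_dist x x <= 0)%E.
Proof.
apply: ge_ereal_inf; exists (curve_length 0 0 (fun _ : R => x)).
  by exists 0, 0, (fun=> x); split=> //; exists [::]; split.
by rewrite /curve_length set_itv1 integral_set1.
Qed.

(** The margin [e] puts both end times inside an open interval of solutions: pieces of horizontal
    curves must be smooth on a neighbourhood of a closed interval, and a lift must be extendable
    past [T]. *)
Definition lift c (v : 'rV[R]_m) (x : M) (T : R) :=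
  exists (g : R -> M) (e : R), [/\ 0 < e, g 0 = x &
    forall t, - e < t < T + e -> sol c v g t].

Lemma liftW c (v : 'rV[R]_m) (x : M) (S T : R) : S <= T -> lift c v x T -> lift c v x S.
Proof.
move=> ST [g [e [e0 g0 gs]]]; exists g, e; split=> // t /andP[t1 t2].
by apply: gs; apply/andP; split; lra.
Qed.

Lemma lift_agree c (v : 'rV[R]_m) (g1 g2 : R -> M) (e1 e2 S1 S2 : R) :
  atlas c -> 0 < e1 -> 0 < e2 -> 0 <= S1 -> S1 <= S2 -> g1 0 = g2 0 ->
  (forall t, - e1 < t < S1 + e1 -> sol c v g1 t) ->
  (forall t, - e2 < t < S2 + e2 -> sol c v g2 t) ->
  forall t, 0 <= t <= S1 -> g1 t = g2 t.
Proof.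
move=> ac e10 e20 S10 S12 g12 h1 h2 t /andP[t0 t1].
pose e := Num.min e1 e2; have [ee1 ee2] : e <= e1 /\ e <= e2 by rewrite !ge_min !lexx orbT.
have e0 : 0 < e by rewrite lt_min e10 e20.
apply: (sol_unique (a := - e) (b := S1 + e) ac) g12.
- by move=> u /andP[u1 u2]; apply: h1; apply/andP; split; lra.
- by move=> u /andP[u1 u2]; apply: h2; apply/andP; split; lra.
- by apply/andP; split; lra.
- by apply/andP; split; lra.
Qed.

(** By uniqueness [g] and the shifted [h] agree on a neighbourhood of [s], so the curve glued at [s]
    solves the equation at [s] too. *)
Lemma lift_extend c (v : 'rV[R]_m) (g h : R -> M) (a s e k : R) :
  atlas c -> a < s -> 0 < k -> 0 < e ->
  (forall t, a < t < s + k -> sol c v g t) ->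
  (forall t, `|t| < e -> sol c v h t) -> h 0 = g s ->
  exists f : R -> M, (forall t, t <= s -> f t = g t) /\
    forall t, a < t < s + e -> sol c v f t.
Proof.
move=> ac as_ k0 e0 gs hs hg.
pose h' (t : R) := h (- s + t * 1).
have hs' t : s - e < t < s + e -> sol c v h' t.
  move=> /andP[t1 t2]; rewrite -[v]scale1r; apply: sol_affine; apply: hs.
  by rewrite ltr_norml; apply/andP; split; lra.
pose f (t : R) := if t <= s then g t else h' t.
pose l := Num.min (s - a) (Num.min k e).
have l0 : 0 < l by rewrite !lt_min subr_gt0 as_ k0 e0.
have [la lk le_] : [/\ l <= s - a, l <= k & l <= e] by rewrite !ge_min !lexx !orbT.
have gh' t : s - l < t < s + l -> g t = h' t.
  move=> tl; apply: (sol_unique (a := s - l) (b := s + l) ac) (_ : g s = h' s) => //.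
  - by move=> u /andP[u1 u2]; apply: gs; apply/andP; split; lra.
  - by move=> u /andP[u1 u2]; apply: hs'; apply/andP; split; lra.
  - by apply/andP; split; lra.
  - by rewrite /h' mulr1 addNr hg.
exists f; split=> [t ts|t /andP[ta te]]; first by rewrite /f ts.
have [ts|st|->] := ltgtP t s.
- apply: (sol_near_eq _ (gs t _)); last by apply/andP; split; lra.
  apply/near_distP; exists (s - t); first by rewrite subr_gt0.
  move=> u; rewrite ltr_norml => /andP[u1 u2]; rewrite /f.
  by have -> : u <= s by lra.
- apply: (sol_near_eq _ (hs' t _)); last by apply/andP; split; lra.
  apply/near_distP; exists (t - s); first by rewrite subr_gt0.
  move=> u; rewrite ltr_norml => /andP[u1 u2]; rewrite /f.
  by have -> : (u <= s) = false by apply/negbTE; rewrite -ltNge; lra.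
- apply: (sol_near_eq _ (gs s _)); last by apply/andP; split; lra.
  apply/near_distP; exists l => // u; rewrite ltr_norml => /andP[u1 u2]; rewrite /f.
  by case: ifP => // _; apply: gh'; apply/andP; split; lra.
Qed.

(** The Cauchy condition is about ordered pairs; the other order is obtained by running the lift
    backwards, with velocity [- v]. *)
Lemma sol_dist_sym c (q v : 'rV[R]_m) (g : R -> M) (a b a' b' C : R) : atlas c ->
  a' < a -> a < b -> b < b' -> 0 <= C ->
  (forall t, a' < t < b' -> sol c v g t) ->
  (forall t, a <= t <= b -> to_coord c (p (g t)) = q + t *: v) ->
  (forall t, a <= t <= b -> gform (metric c (q + t *: v)) v v <= C ^+ 2) ->
  (riemannian_dist (g b) (g a) <= (C * (b - a))%:E)%E.
Proof.
move=> ac a'a ab bb' C0 gs gq gC.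
have := @sol_dist c q (- v) (fun t => g (0 + t * -1)) (- b) (- a) (- b') (- a') C ac.
rewrite !ltrN2 !add0r !mulrN1 !opprK [- a + b]addrC => /(_ bb' ab a'a C0).
apply.
- move=> t /andP[t1 t2]; rewrite -scaleN1r; apply: sol_affine; apply: gs.
  by apply/andP; split; lra.
- move=> t /andP[t1 t2]; rewrite add0r mulrN1 gq ?scalerN ?scaleNr//.
  by apply/andP; split; lra.
- move=> t /andP[t1 t2]; rewrite scalerN -scaleNr /gform linearN mulmxN !mulNmx opprK.
  by apply: gC; apply/andP; split; lra.
Qed.

Hypothesis M_complete : complete_manifold M.

Lemma speed_bounded c (q v : 'rV[R]_m) (T : R) : atlas c -> 0 <= T ->
  (forall t, 0 <= t <= T -> chart_cod c (q + t *: v)) ->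
  exists2 C : R, 0 < C &
    forall t, 0 <= t <= T -> gform (metric c (q + t *: v)) v v <= C ^+ 2.
Proof.
move=> ac T0 qc; pose f (t : R) := gform (metric c (q + t *: v)) v v.
have [|t0 _ ht] := @EVT_max R f 0 T T0.
  apply: continuous_in_subspaceT => t; rewrite inE/= in_itv/= => tT.
  by apply: speed_continuous => //; exact: qc.
(* Only an upper bound that is a square is wanted, and [(|f t0| + 1) ^+ 2] exceeds [f t0]. *)
exists (`|f t0| + 1); first by rewrite ltr_wpDl.
move=> t tT; apply: (@le_trans _ _ (f t0)); first by apply: ht; rewrite in_itv.
apply: le_trans (ler_norm _) _; rewrite expr2.
by have := normr_ge0 (f t0); nra.
Qed.

(* The lift has bounded speed, so its values at times increasing to [T] form a
   Cauchy sequence. *)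
Lemma lift_limit c (x : M) (v : 'rV[R]_m) (T : R) : atlas c -> chart_dom c (p x) ->
  0 < T -> (forall t, 0 <= t <= T -> chart_cod c (to_coord c (p x) + t *: v)) ->
  (forall s : R, 0 <= s < T -> lift c v x s) -> lift c v x T.
Proof.
move=> ac xc T0 qc hl; set q := to_coord c (p x) in qc.
have [C C0 hC] := speed_bounded ac (ltW T0) qc.
(* The lifts up to the various times [s < T] are chosen independently; [agree] below shows that they
   are restrictions of one curve. *)
have hl' (s : R) : exists g : R -> M, 0 <= s < T -> exists e : R, [/\ 0 < e, g 0 = x &
    forall t, - e < t < s + e -> sol c v g t].
  have [sT|sT] := boolP (0 <= s < T); last by exists (fun=> x).
  by have [g [e h]] := hl s sT; exists g => _; exists e.
have [G hG] := choice hl'.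
have Gq (s t : R) : 0 <= s < T -> 0 <= t <= s -> to_coord c (p (G s t)) = q + t *: v.
  move=> sT /andP[t0 ts]; have [e [e0 Gs0 Gs]] := hG s sT; case/andP: sT => s0 sT.
  rewrite (sol_line ac Gs (_ : - e < 0 < s + e)) ?Gs0 ?subr0//.
    by apply/andP; split; lra.
  by apply/andP; split; lra.
have agree (s s' t : R) : 0 <= s -> s <= s' -> s' < T -> 0 <= t <= s -> G s t = G s' t.
  move=> s0 ss sT; have [|e [e0 Gs0 Gs]] := hG s; first by rewrite s0 (le_lt_trans ss).
  have [|e' [e'0 Gs0' Gs']] := hG s'; first by rewrite (le_trans s0 ss).
  have g12 : G s 0 = G s' 0 by rewrite Gs0 Gs0'.
  exact: (lift_agree ac e0 e'0 s0 ss g12 Gs Gs').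
pose s (k : nat) : R := T - T / k.+2%:R.
have sT k : 0 <= s k < T.
  rewrite /s; have k2 : (0 : R) < k.+2%:R by [].
  rewrite subr_ge0 ler_pdivrMr// ler_peMr ?(ltW T0)//=; last by rewrite ler1n.
  by rewrite ltrBlDr ltrDl divr_gt0.
have smono i j : (i <= j)%N -> s i <= s j.
  by move=> ij; rewrite lerD2l lerN2 ler_pM2l// lef_pV2 ?posrE// ler_nat.
pose u k := G (s k) (s k).
have dst i j : (i < j)%N -> let D := (C * (T / i.+2%:R))%:E in
    ((riemannian_dist (u i) (u j) <= D) /\ (riemannian_dist (u j) (u i) <= D))%E.
  move=> ij D; have sij := smono i j (ltnW ij).
  have sij' : s i < s j.
    by rewrite ltrD2l ltrN2 ltr_pM2l// ltf_pV2 ?posrE// ltr_nat.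
  have /andP[si0 siT] := sT i; have /andP[sj0 sjT] := sT j.
  have ui : u i = G (s j) (s i) by rewrite /u (agree (s i) (s j))// si0 lexx.
  have [e [e0 _ Gs]] := hG (s j) (sT j).
  have h1 : - e < s i by lra.
  have h2 : s j < s j + e by lra.
  have gq t : s i <= t <= s j -> to_coord c (p (G (s j) t)) = q + t *: v.
    by move=> /andP[t1 t2]; apply: Gq => //; apply/andP; split; lra.
  have gC t : s i <= t <= s j -> gform (metric c (q + t *: v)) v v <= C ^+ 2.
    by move=> /andP[t1 t2]; apply: hC; apply/andP; split; lra.
  have le1 : ((C * (s j - s i))%:E <= D)%E.
    rewrite lee_fin; apply: ler_wpM2l; first exact: ltW.
    have : 0 <= T / j.+2%:R by rewrite divr_ge0// ltW.
    by rewrite /s; move: (T / j.+2%:R) (T / i.+2%:R) => a b; lra.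
  split; apply: le_trans le1; rewrite ui.
    exact: (sol_dist ac h1 sij' h2 (ltW C0) Gs gq gC).
  exact: (sol_dist_sym ac h1 sij' h2 (ltW C0) Gs gq gC).
have small (e : R) : 0 < e -> exists N : nat, forall i, (N <= i)%N -> T / i.+2%:R < e.
  move=> e0; have Te0 : 0 <= T / e by rewrite divr_ge0// ltW.
  exists (Num.bound (T / e)) => i Ni; rewrite ltr_pdivrMr// mulrC -ltr_pdivrMr//.
  apply: lt_le_trans (archi_boundP Te0) _; rewrite ler_nat.
  by rewrite (leq_trans Ni)// (leq_trans (leqnSn _))// leqnSn.
have cau : forall e : R, 0 < e -> exists N : nat, forall i j : nat,
       (N <= i)%N -> (N <= j)%N -> (riemannian_dist (u i) (u j) < e%:E)%E.
  move=> e e0; have [N hN] := small (e / C) (divr_gt0 e0 C0).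
  have hN' i : (N <= i)%N -> ((C * (T / i.+2%:R))%:E < e%:E)%E.
    by move=> /hN; rewrite lte_fin ltr_pdivlMr// mulrC.
  exists N => i j Ni Nj; have [ij|ji|->] := ltngtP i j.
  - by apply: le_lt_trans (hN' i Ni); have [] := dst i j ij.
  - by apply: le_lt_trans (hN' j Nj); have [] := dst j i ji.
  - by apply: le_lt_trans (riemannian_distxx _) _; rewrite lte_fin.
have [xs hxs] := M_complete cau.
have s_cvg : s k @[k --> \oo] --> T.
  apply/cvgrPdist_lt => e e0; have [N hN] := small e e0.
  exists N => // k /= /hN; rewrite /s opprB addrC subrK ger0_norm//.
  by rewrite divr_ge0// ltW.
have zc : chart_cod c (q + T *: v) by apply: qc; rewrite ltW// lexx.
(* The limit point lies over the end of the segment, hence over the domain of [c], and the local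
   flow is available around it. *)
have pxs : p xs = of_coord c (q + T *: v).
  apply: (cvg_unique (@carrier_hausdorff _ _ B)) (_ : (p \o u) @ \oo --> p xs) _.
    by apply: cvg_comp hxs _; exact: p_cts.
  have -> : p \o u = fun k => of_coord c (q + s k *: v).
    apply/funext => k /=; have /andP[sk0 skT] := sT k.
    rewrite -(Gq (s k) (s k) (sT k))/u ?sk0 ?lexx//; rewrite to_coordK//.
    have [e [e0 _ Gs]] := hG (s k) (sT k).
    by have [|//] := Gs (s k); apply/andP; split; lra.
  have sv : q + s k *: v @[k --> \oo] --> q + T *: v.
    by apply: cvgD; [exact: cvg_cst|exact: cvgZr_tmp].
  exact: (cvg_comp _ _ sv (of_coord_cts zc)).
have xsc : chart_dom c (p xs) by rewrite pxs; exact: of_coord_dom.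
have Rv0 : 0 < `|v| + 1 by rewrite ltr_wpDl.
(* The time [e] is uniform near [xs]: for [k] large, [u k] is in that neighbourhood and
   [T - s k < e], so the local solution started at [u k] passes beyond [T]. *)
have [N [e [K [e0 _ _ F _]]]] := local_flow ac xsc Rv0.
have [n1 _ hn1] := hxs _ F.
have [n2 hn2] := small e e0.
pose k := maxn n1 n2.
have [|h [h0 hs]] := hn1 k (leq_maxl _ _) v; first by rewrite lerDl.
have Tk := hn2 k (leq_maxr _ _).
have /andP[sk0 skT] := sT k.
have [d [d0 Gs0 Gs]] := hG (s k) (sT k).
have ask : - d < s k by lra.
have hs' t : `|t| < e -> sol c v h t by move=> /hs[].
have [f [fE fs]] := lift_extend ac ask d0 e0 Gs hs' h0.
exists f, (Num.min d (s k + e - T)); split.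
- by rewrite lt_min d0 /s; move: Tk; move: (T / k.+2%:R) => a; lra.
- by rewrite fE.
- move=> t; have [m1 m2] : Num.min d (s k + e - T) <= d /\ Num.min d (s k + e - T) <= s k + e - T.
    by rewrite !ge_min !lexx orbT.
  by move=> /andP[t1 t2]; apply: fs; apply/andP; split; lra.
Qed.

(** Propagation of [lift c v x] along the interval. If the lift up to [t0] exists, its margin gives
    the later times close to [t0]. If not, [lift_limit] yields some [s0 < t0] without a lift, and
    the predicate is false everywhere near [t0]. *)
Lemma lift_exists c (x : M) (v : 'rV[R]_m) : atlas c -> chart_dom c (p x) ->
  (forall t, 0 <= t <= 1 -> chart_cod c (to_coord c (p x) + t *: v)) -> lift c v x 1.
Proof.
move=> ac xc qc.
have L0 : lift c v x 0.
  have Rv0 : 0 < `|v| + 1 by rewrite ltr_wpDl.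
  have [N [e [K [e0 _ _ F _]]]] := local_flow ac xc Rv0.
  have [|g [g0 gs]] := nbhs_singleton F v; first by rewrite lerDl.
  exists g, e; split=> // t /andP[t1 t2]; have [] // := gs t _.
  by rewrite ltr_norml; apply/andP; split; lra.
apply: (@interval_propagation R 0 1 (lift c v x)) => //; last by rewrite ler01 lexx.
move=> t0 /andP[t00 t01].
have [[g [e [e0 g0 gs]]]|L] := pselect (lift c v x t0).
  exists e => // s t _ _ _; rewrite ltr_norml => /andP[t1 t2] _.
  exists g, (Num.min e (t0 + e - t)).
  have [m1 m2] : Num.min e (t0 + e - t) <= e /\ Num.min e (t0 + e - t) <= t0 + e - t.
    by rewrite !ge_min !lexx orbT.
  split=> //; first by rewrite lt_min e0; lra.
  by move=> u /andP[u1 u2]; apply: gs; apply/andP; split; lra.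
have t0p : 0 < t0 by rewrite lt_neqAle t00 andbT; apply/eqP => t0E; apply: L; rewrite -t0E.
have [s0 [s01 Ls0]] : exists s, 0 <= s < t0 /\ ~ lift c v x s.
  apply: contrapT => h; apply: L; apply: lift_limit => //.
    by move=> t /andP[h1 h2]; apply: qc; apply/andP; split; lra.
  by move=> s sT; apply: contrapT => Ls; apply: h; exists s.
case/andP: s01 => h1 h2; exists (t0 - s0); first by rewrite subr_gt0.
move=> s t _ _; rewrite ltr_norml => /andP[s1 s2] _ Ls; exfalso; apply: Ls0.
by apply: liftW Ls; lra.
Qed.

Lemma sol_local_agree c (v : 'rV[R]_m) (g h : R -> M) (a b e s t : R) : atlas c ->
  (forall u, a < u < b -> sol c v g u) -> (forall u, `|u| < e -> sol c v h u) ->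
  h 0 = g s -> a < s < b -> a < t < b -> `|t - s| < e -> h (t - s) = g t.
Proof.
move=> ac gs hs hg /andP[s1 s2] /andP[t1 t2]; rewrite ltr_norml => /andP[ts1 ts2].
pose h' (t : R) := h (- s + t * 1).
have hs' u : s - e < u < s + e -> sol c v h' u.
  move=> /andP[u1 u2]; rewrite -[v]scale1r; apply: sol_affine; apply: hs.
  by rewrite ltr_norml; apply/andP; split; lra.
have -> : h (t - s) = h' t by rewrite /h' mulr1 addrC.
apply: (sol_unique (a := Num.max a (s - e)) (b := Num.min b (s + e)) ac) (_ : h' s = g s).
- move=> u; rewrite gt_max lt_min => /andP[/andP[? ?] /andP[? ?]].
  by apply: hs'; apply/andP; split; lra.
- move=> u; rewrite gt_max lt_min => /andP[/andP[? ?] /andP[? ?]].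
  by apply: gs; apply/andP; split; lra.
- by rewrite gt_max lt_min; apply/andP; split; apply/andP; split; lra.
- by rewrite gt_max lt_min; apply/andP; split; apply/andP; split; lra.
- by rewrite /h' mulr1 addNr.
Qed.

(** * The end point of the lift of a segment as a function of its data *)

Definition chart_ball c (z : 'rV[R]_m) (r : R) : set B :=
  [set b | chart_dom c b /\ `|to_coord c b - z| < r].

Lemma chart_ball_open c z r : open (chart_ball c z r).
Proof.
rewrite openE => b [bc br].
have h1 : nbhs b (chart_dom c) by apply: open_nbhs_nbhs; split=> //; exact: chart_dom_open.
have h2 : \forall y \near b, `|to_coord c y - z| < r.
  have rp : 0 < r - `|to_coord c b - z| by rewrite subr_gt0.
  have := to_coord_cts bc => /cvgrPdist_lt /(_ _ rp); apply: filterS => y.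
  rewrite ltrBrDr => h; rewrite -(subrKA (to_coord c b)).
  by apply: le_lt_trans (ler_normD _ _) _; rewrite distrC.
by apply: filterS (filterI h1 h2) => y [].
Qed.

Definition segment_dir c (w : M * B) : 'rV[R]_m := to_coord c w.2 - to_coord c (p w.1).

(* The end point of the horizontal lift starting at [w.1] of the segment of the
   chart [c] from [p w.1] to [w.2]; the junk value [w.1] when there is no lift. *)
Definition sigma c (w : M * B) : M :=
  if pselect (lift c (segment_dir c w) w.1 1) is left h then projT1 (cid h) 1 else w.1.

Section Sigma.
Context (c : chart R m B) (z : 'rV[R]_m) (r : R).
Hypothesis ac : atlas c.
Hypothesis zr : forall y, `|y - z| < r -> chart_cod c y.
Let V := chart_ball c z r.
Let good (w : M * B) := V (p w.1) /\ V w.2.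

(** A ball of coordinates is convex, so the segment between two of its points stays in the chart. *)
Lemma good_lift w : good w -> lift c (segment_dir c w) w.1 1.
Proof.
move=> [[d1 r1] [d2 r2]]; apply: lift_exists => // t /andP[t0 t1]; apply: zr.
set y1 := to_coord c (p w.1) in r1 *; set y2 := to_coord c w.2 in r2 *.
have -> : y1 + t *: segment_dir c w - z = (1 - t) *: (y1 - z) + t *: (y2 - z).
  by rewrite /segment_dir -/y1 -/y2; apply/rowP => i; rewrite !mxE; ring.
apply: le_lt_trans (ler_normD _ _) _; rewrite !normrZ.
rewrite [`|1 - t|]ger0_norm ?subr_ge0// [`|t|]ger0_norm//.
have [tt|tt] := ltP t 1.
  have h1 : (1 - t) * `|y1 - z| < (1 - t) * r by rewrite ltr_pM2l// subr_gt0.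
  have h2 : t * `|y2 - z| <= t * r by apply: ler_wpM2l => //; exact: ltW.
  by have := ltr_leD h1 h2; rewrite -mulrDl subrK mul1r.
have -> : t = 1 by apply/eqP; rewrite eq_le t1 tt.
by rewrite subrr mul0r add0r mul1r.
Qed.

Lemma sigmaP w : good w -> exists (g : R -> M) (e : R), [/\ 0 < e, g 0 = w.1,
  forall t, - e < t < 1 + e -> sol c (segment_dir c w) g t & sigma c w = g 1].
Proof.
move=> gw; rewrite /sigma; case: pselect => [h|]; last by move=> /(_ (good_lift gw)).
by case: (cid h) => g /= [e [e0 g0 gs]]; exists g, e.
Qed.

Lemma p_sigma w : good w -> p (sigma c w) = w.2.
Proof.
move=> gw; have [g [e [e0 g0 gs ->]]] := sigmaP gw; case: gw => [[d1 r1] [d2 r2]].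
have s0 : - e < 0 < 1 + e by apply/andP; split; lra.
have s1 : - e < 1 < 1 + e by apply/andP; split; lra.
have := sol_line ac gs s0 s1; rewrite subr0 scale1r g0 /segment_dir addrC subrK => h.
rewrite -(to_coordK d2) -h to_coordK//.
by have [] := gs 1 s1.
Qed.

(** A constant curve solves the equation with velocity 0, and solutions are unique. The gluing of
    lifts rests on this. *)
Lemma sigma_id w : good w -> p w.1 = w.2 -> sigma c w = w.1.
Proof.
move=> gw pw; have [g [e [e0 g0 gs ->]]] := sigmaP gw; case: gw => [[d1 r1] [d2 r2]].
have v0 : segment_dir c w = 0 by rewrite /segment_dir pw subrr.
have hs t : - e < t < 1 + e -> sol c (segment_dir c w) (fun=> w.1) t.
  move=> _; split=> //; first exact: cvg_cst.
  by move=> d ad _; rewrite v0 mul0mx; exact: is_derive_cst.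
apply: (lift_agree ac e0 e0 ler01 (lexx 1) (g1 := g) (g2 := fun=> w.1) g0 gs hs).
by rewrite ler01 lexx.
Qed.

Lemma sigma_leaf w : good w -> dual_leaf p w.1 (sigma c w).
Proof.
move=> gw; have [g [e [e0 g0 gs ->]]] := sigmaP gw.
by rewrite -g0; exact: sol_dual_leaf ac e0 gs.
Qed.

Lemma near_good w : good w -> \forall w' \near w, good w'.
Proof.
move=> [g1 g2]; case: w => x b /= in g1 g2 *.
have h1 : \forall w' \near (x, b), V (p w'.1).
  have c1 : {for (x, b), continuous (fun w' : M * B => p w'.1)}.
    by apply: continuous_comp; [exact: cvg_fst|exact: p_cts].
  by apply: c1; apply: open_nbhs_nbhs; split=> //; exact: chart_ball_open.
have h2 : \forall w' \near (x, b), V w'.2.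
  have c2 : {for (x, b), continuous (fun w' : M * B => w'.2)} by exact: cvg_snd.
  by apply: c2; apply: open_nbhs_nbhs; split=> //; exact: chart_ball_open.
by apply: filterS (filterI h1 h2) => w' [].
Qed.

Lemma vec_continuous w : good w -> {for w, continuous (segment_dir c)}.
Proof.
move=> [[d1 r1] [d2 r2]]; case: w => x b /= in d1 r1 d2 r2 *.
apply: cvgB.
  apply: continuous_comp; first exact: cvg_snd.
  exact: to_coord_cts.
apply: (@continuous_comp _ _ _ (fun w' : M * B => p w'.1)).
  by apply: continuous_comp; [exact: cvg_fst|exact: p_cts].
exact: to_coord_cts.
Qed.

(** Continuity in [w'] of the position at time [t] is propagated from [t = 0] to [t = 1]; at each
    [t0] the local flow around [G w t0] carries it between any two nearby times, in both
    directions. *)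
Lemma sigma_continuous w : good w -> {for w, continuous (sigma c)}.
Proof.
move=> gw.
have hG (w' : M * B) : exists g : R -> M, good w' -> exists e : R, [/\ 0 < e, g 0 = w'.1,
    forall t, - e < t < 1 + e -> sol c (segment_dir c w') g t & sigma c w' = g 1].
  have [gw'|gw'] := pselect (good w'); last by exists (fun=> w'.1).
  by have [g [e h]] := sigmaP gw'; exists g => _; exists e.
have [G hG'] := choice hG.
pose P (t : R) := G w' t @[w' --> w] --> G w t.
suff P1 : P 1.
  rewrite /prop_for /continuous_at.
  have [e [_ _ _ ->]] := hG' w gw.
  apply: cvg_trans P1; apply: near_eq_cvg.
  apply: filterS (near_good gw) => w' /hG'[e' [_ _ _ ->]] //.
apply: (@interval_propagation R 0 1 P); last by rewrite ler01 lexx.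
  rewrite /P; have [e [_ -> _ _]] := hG' w gw.
  apply: (@cvg_trans _ (w'.1 @[w' --> w])); last by case: (w) => x b; exact: cvg_fst.
  apply: near_eq_cvg; apply: filterS (near_good gw) => w' /hG'[e' [_ -> _ _]] //.
move=> t0 /andP[t00 t01].
have [E [E0 G0 Gs _]] := hG' w gw.
have st0 : sol c (segment_dir c w) (G w) t0 by apply: Gs; apply/andP; split; lra.
have [gcd gc _] := st0.
set v := segment_dir c w in Gs st0 *.
have Rv0 : 0 < `|v| + 1 by rewrite ltr_wpDl.
have [N [e [K [e0 xN Nd F D]]]] := local_flow ac gcd Rv0.
set d := chart_at (G w t0) in Nd D.
(* The starting points from which the local flow exists for all velocities of norm at most
   [|v| + 1]. *)
set W := (fun x : M => _) in F.
have F' : nbhs (G w t0) (fun x => nbhs x W) by exact: nbhs_interior F.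
have : \forall t \near t0, nbhs (G w t) W by exact: (gc _ F').
move=> /near_distP[k1 k10 hk1].
pose k := Num.min k1 (e / 2).
have k0 : 0 < k by rewrite lt_min k10 divr_gt0.
have [kk1 ke] : k <= k1 /\ k <= e / 2 by rewrite !ge_min !lexx orbT.
exists k => // s t /andP[s0 s1] /andP[tt0 t1].
rewrite !ltr_norml => /andP[sk1 sk2] /andP[tk1 tk2] Ps.
have tse : `|t - s| < e by rewrite ltr_norml; apply/andP; split; lra.
have Ws : nbhs (G w s) W by apply: hk1; rewrite ltr_norml; apply/andP; split; lra.
(* The comparison estimate requires curves that stay in [N]. Around time [s] the lift for [w'] is,
   by uniqueness, the local solution started at [G w' s], which does stay there. *)
have loc w' : good w' -> W (G w' s) -> `|segment_dir c w'| <= `|v| + 1 ->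
  exists h : R -> M, [/\ h 0 = G w' s, h (t - s) = G w' t &
    forall u, `|u| < e -> N (h u) /\ sol c (segment_dir c w') h u].
  move=> gw' Ww' vw'; have [h [h0 hs]] := Ww' _ vw'.
  have [e' [e'0 _ Gs' _]] := hG' w' gw'.
  exists h; split=> //; apply: (sol_local_agree (b := 1 + e') (a := - e') ac Gs' _ h0 _ _ tse).
  - by move=> u /hs[].
  - by apply/andP; split; lra.
  - by apply/andP; split; lra.
have [|h [h0 ht hs]] := loc w gw (nbhs_singleton Ws); first by rewrite lerDl.
have Ns : N (G w s) by rewrite -h0; have [] // := hs 0; rewrite normr0.
have Nt : N (G w t) by rewrite -ht; have [] := hs _ tse.
have near_v : \forall w' \near w, `|segment_dir c w'| <= `|v| + 1.
  have /cvgrPdist_le /(_ 1 ltr01) := vec_continuous gw; apply: filterS => w' hw'.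
  by rewrite -[segment_dir c w'](subKr v) (le_trans (ler_normB _ _))// lerD2l.
have near_W : \forall w' \near w, W (G w' s) by exact: Ps.
pose q w' := 2 * (`|to_coord d (G w' s) - to_coord d (G w s)| +
  (e - - e) * (K * `|segment_dir c w' - v|)).
have near_q : \forall w' \near w, N (G w' t) /\
    `|to_coord d (G w' t) - to_coord d (G w t)| <= q w'.
  apply: filterS (filterI (near_good gw) (filterI near_W near_v)) => w' [gw' [Ww' vw']].
  have [h' [h'0 h't hs']] := loc w' gw' Ww' vw'.
  split; first by rewrite -h't; have [] := hs' _ tse.
  have := D (segment_dir c w') v h' h (- e) e vw' _ _ _ _ 0 (t - s) _ _.
  rewrite h't ht h'0 h0; apply.
  - by rewrite lerDl.
  - by lra.
  - by move=> u ue; apply: hs'; rewrite ltr_norml.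
  - by move=> u ue; apply: hs; rewrite ltr_norml.
  - by rewrite oppr_lt0 e0.
  - by rewrite -ltr_norml.
have cs : to_coord d (G w' s) @[w' --> w] --> to_coord d (G w s).
  by apply: (cvg_comp _ _ Ps); apply: to_coord_cts; exact: Nd.
have q0 : q w' @[w' --> w] --> (0 : R).
  have -> : (0 : R) = 2 * (`|to_coord d (G w s) - to_coord d (G w s)| +
      (e - - e) * (K * `|v - v|)).
    by rewrite !subrr !normr0 !mulr0 addr0 mulr0.
  apply: cvgMr; apply: cvgD.
    by apply: cvg_norm; apply: cvgB => //; exact: cvg_cst.
  apply: cvgMr; apply: cvgMr; apply: cvg_norm; apply: cvgB; last exact: cvg_cst.
  exact: vec_continuous.
have ct : to_coord d (G w' t) @[w' --> w] --> to_coord d (G w t).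
  apply/cvgrPdist_le => f f0; have /cvgrPdist_le /(_ f f0) hq := q0.
  apply: filterS (filterI near_q hq) => w' [[_ h1] h2].
  rewrite distrC; apply: le_trans h1 _; apply: le_trans h2.
  by rewrite sub0r normrN ler_norm.
have := cvg_comp _ _ ct (of_coord_cts (to_coord_cod (Nd _ Nt))).
rewrite to_coordK; last exact: Nd.
apply: cvg_trans; apply: near_eq_cvg.
by apply: filterS near_q => w' [Nw' _]; rewrite /= to_coordK//; exact: Nd.
Qed.

End Sigma.

(** * Dual leaves *)

(** One smooth horizontal piece. Chains of pieces make transitivity and symmetry simple inductions,
    whereas [dual_leaf] would require concatenating and reversing lists of break points. *)
Definition hseg (x y : M) := exists (a b : R) (O : set R) (g : R -> M),
  [/\ a < b, open O, (forall t, a <= t <= b -> O t) & smooth_curve O g] /\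
  [/\ forall t, a < t < b -> horizontal p (g t) (velocity g t), g a = x & g b = y].

Inductive hchain (x : M) : M -> Prop :=
| hchain_nil : hchain x x
| hchain_rcons y z : hchain x y -> hseg y z -> hchain x z.

Lemma hchain_trans x y z : hchain x y -> hchain y z -> hchain x z.
Proof. by move=> xy; elim=> // u w _ xu uw; exact: hchain_rcons xu uw. Qed.

Lemma hchain1 x y : hseg x y -> hchain x y.
Proof. by apply: hchain_rcons; exact: hchain_nil. Qed.

Lemma Ck_on_affine (W : normedModType R) (U : set R) (f : R -> W) (a b : R) k :
  Ck_on k U f -> Ck_on k [set s | U (a + s * b)] (fun s => f (a + s * b)).
Proof.
have E (h : R -> W) (s w : R) :
    (fun k : R => k^-1 *: (((fun s => h (a + s * b)) \o shift s) (k *: w) - h (a + s * b))) =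
    (fun k : R => k^-1 *: ((h \o shift (a + s * b)) (k *: (w * b)) - h (a + s * b))).
  apply/funext => l /=; congr (_ *: (h _ - _)).
  by change (a + (l * w + s) * b = l * (w * b) + (a + s * b)); ring.
have cts (h : R -> W) (s : R) : {for a + s * b, continuous h} ->
    {for s, continuous (fun s : R => h (a + s * b))}.
  move=> hc; have ca : {for s, continuous (fun s : R => a + s * b)}.
    by apply: cvgD; [exact: cvg_cst|apply: cvgMl; exact: cvg_id].
  exact: (@continuous_comp _ _ _ (fun s : R => a + s * b) h s ca hc).
elim: k f => [|k IH] f [fc fd]; split=> //.
- by move=> s Us; apply: cts; exact: fc.
- by move=> s Us; apply: cts; exact: fc.
move=> w; have [dv dC] := fd (w * b); split=> [s Us|].
  by rewrite /derivable E; exact: dv.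
have -> : 'D_w (fun s : R => f (a + s * b)) = (fun s : R => ('D_(w * b) f) (a + s * b)).
  by apply/funext => s; rewrite /derive E.
exact: (IH _ dC).
Qed.

Lemma smooth_curve_affine (O : set R) (g : R -> M) (a b : R) : smooth_curve O g ->
  smooth_curve [set s | O (a + s * b)] (fun s => g (a + s * b)).
Proof.
move=> [gc gs]; split=> [t Ot|d ad k].
  apply: continuous_comp; last exact: gc.
  by apply: cvgD; [exact: cvg_cst|apply: cvgMl; exact: cvg_id].
exact: (@Ck_on_affine _ _ (fun t => to_coord d (g t)) a b k (gs d ad k)).
Qed.

Lemma open_affine (O : set R) (a b : R) : open O -> open [set s : R | O (a + s * b)].
Proof.
move=> oO; apply: (@open_comp _ _ (fun s : R => a + s * b)) oO => s _.
by apply: cvgD; [exact: cvg_cst|apply: cvgMl; exact: cvg_id].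
Qed.

Lemma smooth_curve_derivable (O : set R) (g : R -> M) d t : open O -> smooth_curve O g ->
  O t -> atlas d -> chart_dom d (g t) -> derivable (fun s => to_coord d (g s)) t 1.
Proof.
move=> oO [gc gs] Ot ad gd; have [_ /(_ 1)[+ _]] := gs d ad 1%N.
by apply; split.
Qed.

Lemma horizontalZ x u (k : R) : horizontal p x u -> horizontal p x (k *: u).
Proof.
move=> h w hw; have := h w hw.
by rewrite /inner /gform -!scalemxAl [in X in _ -> X]mxE => ->; rewrite mulr0.
Qed.

Lemma velocity_affine (O : set R) (g : R -> M) (a b t : R) : open O -> smooth_curve O g ->
  O (a + t * b) ->
  velocity (fun s => g (a + s * b)) t = b *: velocity g (a + t * b).
Proof.
move=> oO gs Ot; rewrite /velocity; set d := chart_at _.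
have D := smooth_curve_derivable oO gs Ot (chart_at_atlas _) (chart_at_dom _).
have [_ ->] := @is_derive_affine _ (fun s => to_coord d (g s)) _ a b t (derivableP D).
by [].
Qed.

Lemma hseg_sym x y : hseg x y -> hseg y x.
Proof.
move=> [a [b [U [g [[ab oO OI gs] [gh ga gb]]]]]].
exists (- b), (- a), [set s | U (0 + s * -1)], (fun s => g (0 + s * -1)).
split; split=> //.
- by rewrite ltrN2.
- exact: open_affine.
- by move=> t /andP[t1 t2]; apply: OI; rewrite add0r mulrN1; apply/andP; split; lra.
- exact: smooth_curve_affine.
- move=> t /andP[t1 t2].
  have tab : a < 0 + t * -1 < b by rewrite add0r mulrN1; apply/andP; split; lra.
  rewrite (velocity_affine oO gs); first exact/horizontalZ/gh.
  by apply: OI; case/andP: tab => *; rewrite !ltW.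
- by rewrite add0r mulrN1 opprK.
- by rewrite add0r mulrN1 opprK.
Qed.

Lemma hchain_sym x y : hchain x y -> hchain y x.
Proof.
elim=> [|z w _ zx zw]; first exact: hchain_nil.
by apply: hchain_trans zx; apply: hchain1; exact: hseg_sym.
Qed.

Lemma velocity_near_eq (g h : R -> M) t : (\forall s \near t, g s = h s) ->
  velocity g t = velocity h t.
Proof.
move=> gh; rewrite /velocity (nbhs_singleton gh); apply: near_eq_derive.
by apply: filterS gh => s ->.
Qed.

Lemma near_eq_oo (T : Type) (g h : R -> T) (a b t : R) : a < t < b ->
  (forall s, a < s < b -> g s = h s) -> \forall s \near t, g s = h s.
Proof.
move=> tab gh; have [e e0 he] := near_interval tab.
apply/near_distP; exists e => // s; rewrite distrC => /he; exact: gh.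
Qed.

Lemma dual_leaf_hchain x y : dual_leaf p x y -> hchain x y.
Proof.
move=> [a [b [g [[s [sab sP] sh] ga gb]]]].
elim: s a x ga sab sP sh => [|u s IH] a x ga sab sP sh.
  by rewrite -ga -gb (itv_partition_nil sab); exact: hchain_nil.
have au : a < u by case: sab => /= /andP[].
have us : itv_partition u b s by exact: itv_partition_cons sab.
have ub := itv_partition_le us.
apply: (@hchain_trans _ (g u)); last first.
  apply: (IH u) => //.
    by move=> i si; have := sP i.+1 si.
  move=> t /andP[ut tb] ts; apply: sh; first by rewrite (lt_trans au ut) tb.
  by rewrite inE negb_or ts andbT gt_eqF.
apply: hchain1; have [U [h [oO JO hs hg]]] := sP 0%N isT.
have inJ t : a <= t <= u -> `[nth b (a :: u :: s) 0%N, nth b (u :: s) 0%N]%classic t.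
  by rewrite /= in_itv.
exists a, u, U, h; split; split=> //.
- move=> t tau.
  (* [velocity] is a two-sided derivative, so the piece and [g] can be exchanged only at times
     interior to the piece. *)
  have gh : \forall s \near t, h s = g s.
    apply: (near_eq_oo tau) => v /andP[v1 v2]; apply: hg; apply: inJ.
    by rewrite !ltW.
  rewrite (velocity_near_eq gh) (nbhs_singleton gh); apply: sh.
    by case/andP: tau => -> tu; rewrite (lt_le_trans tu ub).
  case/andP: tau => _ tu; rewrite inE negb_or lt_eqF//=.
  apply/negP => ts; case: us => /(order_path_min lt_trans)/allP/(_ t ts) /= ut _.
  by have := lt_trans tu ut; rewrite ltxx.
- by rewrite hg ?ga//; apply: inJ; rewrite lexx ltW.
- by apply: hg; apply: inJ; rewrite lexx ltW.
Qed.

Lemma dual_leaf_rcons x y z : dual_leaf p x y -> hseg y z -> dual_leaf p x z.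
Proof.
move=> [a [b [g [[s sab sh] ga gb]]]] [c [d [U [h [[cd oU UI hs] [hh hc hd]]]]]].
have [spart sP] := sab; have ab := itv_partition_le spart.
pose e := b + (d - c); have be : b < e by rewrite /e; lra.
pose h' (t : R) := h (c - b + t * 1).
pose U' := [set t : R | U (c - b + t * 1)].
pose f (t : R) := if t <= b then g t else h' t.
have h'b : h' b = g b by rewrite /h' mulr1 subrK hc gb.
have fg t : t <= b -> f t = g t by rewrite /f => ->.
have fh t : b <= t -> f t = h' t.
  rewrite le_eqVlt /f => /orP[/eqP <-|bt]; first by rewrite lexx h'b.
  by rewrite leNgt bt.
have lastb : last a s = b by case: spart => _ /eqP.
exists a, e, f; split.
- exists (rcons s e).
  + split.
      by rewrite -cats1; apply: itv_partition_cat spart _; exact: itv_partition1.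
    move=> i; rewrite size_rcons ltnS leq_eqVlt => /orP[/eqP ->|si].
      have -> : nth e (a :: rcons s e) (size s) = b.
        rewrite -rcons_cons nth_rcons /= ltnS leqnn -lastb.
        by case: (s) => //= u s'; rewrite (last_nth e).
      have -> : nth e (rcons s e) (size s) = e by rewrite nth_rcons ltnn eqxx.
      exists U', h'; split.
      * exact: open_affine.
      * move=> t; rewrite /= in_itv/= => /andP[t1 t2]; apply: UI.
        by move: t2; rewrite /e mulr1 => t2; apply/andP; split; lra.
      * exact: smooth_curve_affine.
      * by move=> t; rewrite /= in_itv/= => /andP[t1 t2]; rewrite fh.
    have [V [k [oV JV ks kg]]] := sP i si.
    have -> : nth e (a :: rcons s e) i = nth b (a :: s) i.
      rewrite -rcons_cons nth_rcons /= ltnS (ltnW si).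
      by apply: set_nth_default; rewrite /= ltnS ltnW.
    have -> : nth e (rcons s e) i = nth b s i.
      by rewrite nth_rcons si; exact: set_nth_default.
    exists V, k; split=> // t tJ; rewrite kg// fg//.
    move: tJ; rewrite /= in_itv/= => /andP[_ t2]; apply: le_trans t2 _.
    by have := @itv_partition_nth_le _ _ a b s i.+1 _ spart; apply; rewrite ltnS.
  + move=> t /andP[at_ te]; rewrite mem_rcons inE negb_or => /andP[_ ts].
    have [tb|bt|tb] := ltgtP t b.
    * have E : \forall u \near t, f u = g u.
        apply: (@near_eq_oo _ f g (t - 1) b); first by apply/andP; split=> //; lra.
        by move=> u /andP[_ ub]; rewrite fg// ltW.
      by rewrite (velocity_near_eq E) (nbhs_singleton E); apply: sh => //; rewrite at_ tb.
    * have E : \forall u \near t, f u = h' u.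
        apply: (@near_eq_oo _ f h' b (t + 1)); first by apply/andP; split=> //; lra.
        by move=> u /andP[bu _]; rewrite fh// ltW.
      rewrite (velocity_near_eq E) (nbhs_singleton E).
      have tcd : c < c - b + t * 1 < d by move: te; rewrite /e mulr1 => te; apply/andP; split; lra.
      rewrite (velocity_affine oU hs) ?scale1r; first exact: hh.
      by apply: UI; case/andP: tcd => *; rewrite !ltW.
    (* The time [b] is the last break point, hence excluded; when [s] is empty, [b = a] contradicts
       [a < t]. *)
    * exfalso; move: ts at_; rewrite tb -lastb; case: (s) => [|v s'] /=.
        by rewrite ltxx.
      by rewrite mem_last.
- by rewrite fg.
- by rewrite fh ?ltW// /h' /e mulr1 -hd; congr h; lra.
Qed.

Lemma hchain_dual_leaf x y : hchain x y -> dual_leaf p x y.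
Proof.
elim=> [|z w _ xz zw]; last exact: dual_leaf_rcons xz zw.
exists 0, 0, (fun=> x); split=> //; exists [::]; first by split.
by move=> t /andP[t1 t2]; have := lt_trans t1 t2; rewrite ltxx.
Qed.

Lemma dual_leaf_trans x y z : dual_leaf p x y -> dual_leaf p y z -> dual_leaf p x z.
Proof.
move=> /dual_leaf_hchain xy /dual_leaf_hchain yz.
by apply: hchain_dual_leaf; exact: hchain_trans xy yz.
Qed.

Lemma dual_leaf_sym x y : dual_leaf p x y -> dual_leaf p y x.
Proof. by move=> /dual_leaf_hchain/hchain_sym; exact: hchain_dual_leaf. Qed.

Lemma dual_leaf_refl x : dual_leaf p x x.
Proof. by apply: hchain_dual_leaf; exact: hchain_nil. Qed.

Lemma chart_ball_exists (b0 : B) : exists (c : chart R m B) (z : 'rV[R]_m) (r : R),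
  [/\ atlas c, forall y, `|y - z| < r -> chart_cod c y & chart_ball c z r b0].
Proof.
pose c := chart_at b0; have bd : chart_dom c b0 by exact: chart_at_dom.
have : nbhs (to_coord c b0) (chart_cod c).
  by apply: open_nbhs_nbhs; split; [exact: chart_cod_open|exact: to_coord_cod].
move=> /near_distP[r r0 hr]; exists c, (to_coord c b0), r; split.
- exact: chart_at_atlas.
- by move=> y; rewrite distrC; exact: hr.
- by split=> //; rewrite subrr normr0.
Qed.

(** By [sigma], the projection of a leaf contains all or nothing of each chart ball, so it is open
    and closed in [B]. *)
Lemma dual_leaf_meets_fiber (b0 : B) x : connected [set: B] ->
  exists2 y, dual_leaf p x y & p y = b0.
Proof.
move=> cB; pose S := [set b | exists2 y, dual_leaf p x y & p y = b].
have step (b1 b2 : B) c z r : atlas c -> (forall y, `|y - z| < r -> chart_cod c y) ->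
    chart_ball c z r b1 -> chart_ball c z r b2 -> S b1 -> S b2.
  move=> ac zr h1 h2 [y xy pyb]; rewrite -pyb in h1.
  exists (sigma c (y, b2)); last by rewrite (p_sigma ac zr).
  apply: dual_leaf_trans xy _.
  exact: (@sigma_leaf c z r ac zr (y, b2)).
suff SB : S = [set: B].
  by have : S b0 by rewrite SB.
apply: cB; first by exists (p x); exists x => //; exact: dual_leaf_refl.
- exists S; last by rewrite setTI.
  rewrite openE => b Sb; have [c [z [r [ac zr bV]]]] := chart_ball_exists b.
  have : nbhs b (chart_ball c z r).
    by apply: open_nbhs_nbhs; split=> //; exact: chart_ball_open.
  by apply: filterS => b' b'V; exact: step bV b'V Sb.
- exists S; last by rewrite setTI.
  rewrite -openC openE => b Sb; have [c [z [r [ac zr bV]]]] := chart_ball_exists b.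
  have : nbhs b (chart_ball c z r).
    by apply: open_nbhs_nbhs; split=> //; exact: chart_ball_open.
  by apply: filterS => b' b'V Sb'; apply: Sb; exact: step b'V bV Sb'.
Qed.

(** * Lifting families of paths *)

Lemma continuous_pair_at (T U W : topologicalType) (f : T -> U) (g : T -> W) a :
  {for a, continuous f} -> {for a, continuous g} ->
  {for a, continuous (fun a => (f a, g a))}.
Proof. by move=> fa ga; exact: (cvg_pair fa ga). Qed.

Section PathLifting.
Context {T : topologicalType} {V : normedModType R}.
Variables (rho : T -> V) (K : set V) (H : V * R -> B) (x0 : M).
Hypotheses (rho_cts : continuous rho) (rhoK : forall a, K (rho a))
  (K_compact : compact K) (H_cts : continuous H).

(* The path [t |-> H (rho a, t)] has been lifted up to time [tau a]. *)
Definition lifted_to (tau : T -> R) := exists h : T -> M, [/\ continuous h,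
  forall a, p (h a) = H (rho a, tau a), forall a, dual_leaf p x0 (h a) &
  forall a, (forall t, H (rho a, t) = p x0) -> h a = x0].

Lemma H_rho_continuous tau : continuous tau -> continuous (fun a : T => H (rho a, tau a)).
Proof.
move=> tc a; apply: (@continuous_comp _ _ _ (fun a => (rho a, tau a)) H); last exact: H_cts.
by apply: continuous_pair_at; [exact: rho_cts|exact: tc].
Qed.

(* Near a point where [tau] does not move, [sigma] is the identity: applying
   [sigma] wherever it makes sense glues continuously. *)
Lemma lifted_step c z r (tau tau' : T -> R) : atlas c ->
  (forall y, `|y - z| < r -> chart_cod c y) -> continuous tau' ->
  (forall a : T, (\forall a' \near a, tau' a' = tau a') \/
     (\forall a' \near a, chart_ball c z r (H (rho a', tau a')) /\
                          chart_ball c z r (H (rho a', tau' a')))) ->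
  lifted_to tau -> lifted_to tau'.
Proof.
move=> ac zr tc' loc [h [hc hp hl h0]].
pose w a := (h a, H (rho a, tau' a)).
pose good a := chart_ball c z r (p (h a)) /\ chart_ball c z r (H (rho a, tau' a)).
pose h' a := if pselect (good a) is left _ then sigma c (w a) else h a.
have h'E a : tau' a = tau a -> h' a = h a.
  move=> ta; rewrite /h'; case: pselect => // g.
  by rewrite (sigma_id ac zr)//= hp ta.
have h'S a : chart_ball c z r (H (rho a, tau a)) ->
    chart_ball c z r (H (rho a, tau' a)) -> h' a = sigma c (w a).
  by move=> g1 g2; rewrite /h'; case: pselect => // -[]; split=> //; rewrite hp.
have wc : continuous w.
  by move=> a; apply: continuous_pair_at; [exact: hc|exact: H_rho_continuous].
exists h'; split.
- move=> a; have [E|E] := loc a.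
    have E' : \forall a' \near a, h a' = h' a' by apply: filterS E => a' /h'E.
    rewrite /continuous_at -(nbhs_singleton E').
    by apply: cvg_trans (hc a); apply: near_eq_cvg; apply: filterS E' => a' ->.
  have [g1 g2] := nbhs_singleton E.
  have E' : \forall a' \near a, sigma c (w a') = h' a'.
    by apply: filterS E => a' [? ?]; rewrite h'S.
  rewrite /continuous_at -(nbhs_singleton E').
  apply: (@cvg_trans _ (sigma c (w a') @[a' --> a])).
    by apply: near_eq_cvg; apply: filterS E' => a' ->.
  apply: (@continuous_comp _ _ _ w (sigma c)); first exact: wc.
  by apply: (sigma_continuous ac zr); split=> //=; rewrite hp.
- move=> a; have [E|E] := loc a.
    by rewrite h'E ?hp ?(nbhs_singleton E).
  have [g1 g2] := nbhs_singleton E; rewrite h'S// (p_sigma ac zr)//.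
  by split=> //=; rewrite hp.
- move=> a; rewrite /h'; case: pselect => // g.
  by apply: dual_leaf_trans (hl a) _; exact: (sigma_leaf ac zr (w := w a)).
- move=> a Ha; have ha := h0 a Ha; rewrite /h'; case: pselect => // g.
  by rewrite (sigma_id ac zr) //= Ha ha.
Qed.

Lemma lebesgue_number : exists2 d : R, 0 < d & forall (x : V) (t : R), K x -> 0 <= t <= 1 ->
  exists c z r, [/\ atlas c, forall y, `|y - z| < r -> chart_cod c y &
    forall (x' : V) (t' : R), `|x - x'| < d -> `|t - t'| < d ->
      chart_ball c z r (H (x', t'))].
Proof.
pose A := K `*` `[0, 1]%classic : set (V * R).
have cA : compact A by apply: compact_setX => //; exact: segment_compact.
pose P (d : R) (xt : V * R) := exists c z r,
  [/\ atlas c, forall y, `|y - z| < r -> chart_cod c y &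
   forall (x' : V) (t' : R), `|xt.1 - x'| < d -> `|xt.2 - t'| < d ->
     chart_ball c z r (H (x', t'))].
have : \forall d \near (0 : R)^'+, A `<=` P d.
  move/compact_near_coveringP : cA; apply => -[x t] _.
  have [c [z [r [ac zr bV]]]] := chart_ball_exists (H (x, t)).
  have : nbhs (x, t) (H @^-1` chart_ball c z r).
    by apply: H_cts; apply: open_nbhs_nbhs; split=> //; exact: chart_ball_open.
  move=> /near_distP[d d0 hd].
  (* One half absorbs the distance from [(x1, t1)] to the centre [(x, t)], the other half is the
     radius left around [(x1, t1)]. *)
  have d20 : 0 < d / 2 by rewrite divr_gt0.
  have n1 : \forall xt' \near (x, t), `|(x, t) - xt'| < d / 2.
    by apply/near_distP; exists (d / 2).
  have n2 : \forall e \near (0 : R)^'+, e < d / 2 by exact: nbhs_right_lt.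
  exists ([set xt' : V * R | `|(x, t) - xt'| < d / 2], [set e : R | e < d / 2]).
    by split; [exact: n1|exact: n2].
  move=> [[x1 t1] e] [/= h1 h2]; exists c, z, r; split=> // x' t' /= hx ht.
  apply: hd; move: h1; rewrite !prod_normE /= !gt_max => /andP[h1 h1'].
  apply/andP; split.
    rewrite -(subrKA x1); apply: le_lt_trans (ler_normD _ _) _; lra.
  rewrite -(subrKA t1); apply: le_lt_trans (ler_normD _ _) _; lra.
move=> hnear.
have [d [d0 hd]] : exists d : R, 0 < d /\ A `<=` P d.
  near (0 : R)^'+ => d; exists d; split=> //; near: d; exact: hnear.
exists d => // x t Kx t01; apply: (hd (x, t) _); split=> //.
Unshelve. all: by end_near. Qed.

Lemma compact_net (d : R) : 0 < d ->
  exists l : seq V, (forall x : V, x \in l -> K x) /\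
    forall y : V, K y -> exists2 x, x \in l & `|x - y| < d.
Proof.
move=> d0.
have : cover_compact K by rewrite -compact_cover.
move=> /(_ V K (fun x : V => [set y : V | `|x - y| < d])) [].
- move=> x _; rewrite (_ : [set y | _] = ball x d); first exact: ball_open.
  by rewrite -ball_normE.
- by move=> y Ky; exists y => //=; rewrite subrr normr0.
move=> D' D'K Kcov; exists (finmap.enum_fset D'); split.
  by move=> x xD; have := D'K x xD; rewrite inE.
by move=> y /Kcov[x xD xy]; exists x.
Qed.

(** The clocks are raised from [a] towards [b] around one point [x] of [l] at a time. All end points
    that move during such a step lie in the single chart ball given for [x] and [a], as the window
    is shorter than [d / 4]; so [lifted_step] applies with that chart. *)
Lemma lifted_stage (d a b : R) (l : seq V) (tau : T -> R) :
  0 < d -> a <= b -> b - a < d / 4 ->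
  (forall x : V, x \in l -> exists c z r, [/\ atlas c,
    forall y, `|y - z| < r -> chart_cod c y &
    forall (x' : V) (t' : R), `|x - x'| < d -> `|a - t'| < d ->
      chart_ball c z r (H (x', t'))]) ->
  continuous tau -> (forall s, a <= tau s <= b) -> lifted_to tau ->
  exists tau' : T -> R, [/\ continuous tau', forall s, a <= tau' s <= b,
    lifted_to tau' & forall (x : V) s, x \in l -> `|x - rho s| < d / 4 -> tau' s = b].
Proof.
move=> d0 ab bad; elim: l => [|x l IH] hl tc tab tl; first by exists tau.
have [y yl|tau1 [tc1 tab1 tl1 E1]] := IH _ tc tab tl.
  by apply: hl; rewrite inE yl orbT.
have [c [z [r [ac zr V_H]]]] := hl x (mem_head _ _).
(* [psi] is [b] where [|x - rho s| < d / 4], since then [d / 2 - |x - rho s| > d / 4 > b - a], and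
   it is [a] where [|x - rho s| >= d / 2]. Taking the maximum with [tau1] never sets a clock
   back. *)
pose psi s := Num.min b (a + Num.max 0 (d / 2 - `|x - rho s|)).
pose tau' s := Num.max (tau1 s) (psi s).
have dist_cts : continuous (fun s => `|x - rho s|).
  by move=> s; apply: cvg_norm; apply: cvgB; [exact: cvg_cst|exact: rho_cts].
have psi_cts : continuous psi.
  move=> s.
  have c1 : {for s, continuous (fun s => d / 2 - `|x - rho s|)}.
    by apply: cvgB; [exact: cvg_cst|exact: dist_cts].
  have c2 (k : R) : {for s, continuous (fun _ : T => k)} by exact: cvg_cst.
  have c3 : {for s, continuous (fun s => a + Num.max 0 (d / 2 - `|x - rho s|))}.
    by apply: cvgD (c2 a) _; exact: (continuous_max (c2 0) c1).
  exact: (continuous_min (c2 b) c3).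
have tc' : continuous tau'.
  by move=> s; exact: (continuous_max (tc1 s) (psi_cts s)).
have tab' s : a <= tau' s <= b.
  have /andP[h1 h2] := tab1 s; rewrite /tau' le_max h1 /= ge_max h2 /=.
  by rewrite ge_min lexx.
exists tau'; split=> //.
- apply: (lifted_step ac zr tc' _ tl1) => s.
  (* Within distance [d] of [x] the chart ball is available. Beyond it, [psi] is [a] on a whole
     neighbourhood and the clock does not move. *)
  have [sd|sd] := ltP `|x - rho s| d; [right|left].
    have : \forall s' \near s, `|x - rho s'| < d.
      by exact: (cvgr_lt _ (dist_cts s)).
    apply: filterS => s' hs'.
    have /andP[h1 h2] := tab1 s'; have /andP[h1' h2'] := tab' s'.
    by split; apply: V_H => //; rewrite ltr_norml; apply/andP; split; lra.
  have : \forall s' \near s, d / 2 < `|x - rho s'|.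
    by apply: (cvgr_gt _ (dist_cts s)); lra.
  apply: filterS => s' hs'; rewrite /tau' /psi.
  rewrite [Num.max 0 _]max_l; last by lra.
  by rewrite addr0 [Num.min b a]min_r// max_l//; case/andP: (tab1 s').
- move=> y s; rewrite inE => /orP[/eqP ->|yl] hd.
    rewrite /tau' /psi [Num.max 0 _]max_r; last by lra.
    by rewrite [Num.min b _]min_l ?max_r//; [case/andP: (tab1 s)|lra].
  have := E1 y s yl hd; have /andP[h1 h2] := tab' s => e1.
  by apply/eqP; rewrite eq_le h2 -{1}e1 /tau' le_max lexx.
Qed.

(** Each of the [N] time windows is shorter than [d / 4], and the net has mesh [d / 4]: at the end
    of a stage every clock shows the end of the window, so [tau'] is constant again. *)
Lemma path_lifting : (forall s, H (rho s, 0) = p x0) -> lifted_to (fun=> 1).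
Proof.
move=> H0; have [d d0 hd] := lebesgue_number.
have d40 : 0 < d / 4 by rewrite divr_gt0.
have [l [lK lcov]] := compact_net d40.
pose N := Num.bound (d / 4)^-1.
have dp : 0 < (d / 4)^-1 by rewrite invr_gt0.
have h := archi_boundP (ltW dp); rewrite -/N in h.
have N0 : (0 < N)%N by rewrite -(ltr0n R) (lt_trans dp h).
have Nd : N%:R^-1 < d / 4 by rewrite -[X in _ < X]invrK ltf_pV2// posrE ltr0n.
have NR0 : (0 : R) < N%:R by rewrite ltr0n.
suff st i : (i <= N)%N -> lifted_to (fun=> i%:R / N%:R).
  by have := st N (leqnn N); rewrite divff// gt_eqF.
elim: i => [_|i IH iN].
  rewrite mul0r; exists (fun=> x0); split=> //.
  - by move=> s; exact: cvg_cst.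
  - by move=> _; exact: dual_leaf_refl.
have a01 : 0 <= (i%:R : R) / N%:R <= 1.
  apply/andP; split; first by rewrite divr_ge0.
  by rewrite ler_pdivrMr// mul1r ler_nat ltnW.
have ab : (i%:R : R) / N%:R <= i.+1%:R / N%:R by rewrite ler_pM2r ?invr_gt0// ler_nat.
have bad : (i.+1%:R : R) / N%:R - i%:R / N%:R < d / 4.
  by rewrite -mulrBl -natrB// subSnn mul1r.
have [|||tau' [tc tab tl E]] := lifted_stage d0 ab bad _ _ _ (IH (ltnW iN)) (l := l).
- by move=> x /lK Kx; exact: hd.
- by move=> s; exact: cvg_cst.
- by move=> s; rewrite lexx ab.
suff -> : (fun=> i.+1%:R / N%:R) = tau' by [].
apply/funext => s; have [x xl xs] := lcov _ (rhoK s).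
by rewrite (E x s xl xs).
Qed.

End PathLifting.

End Submersion.

(** * A retraction of the space onto the disc *)

Section DiscRetraction.
Context {R : realType} (q : nat).
Local Notation V := 'rV[R]_q.

Let sq (x : V) : R := \sum_(i < q) x 0 i ^+ 2.

Lemma sum_sqr_continuous : continuous sq.
Proof.
move=> x; have h (i : 'I_q) : {for x, continuous (fun y : V => y 0 i ^+ 2)}.
  have ci : {for x, continuous (fun y : V => y 0 i)} by exact: coord_continuous.
  exact: (cvgM ci ci).
exact: (cvg_bigsum _ h).
Qed.

Lemma disc_compact : compact (@disc R q).
Proof.
apply: bounded_closed_compact.
  exists 1; split=> // k k1 x dx; apply: ltW; apply: le_lt_trans k1.
  apply: mx_norm_le => // i j; rewrite (ord1 i).
  rewrite -(@ler_pXn2r _ 2)// ?nnegrE// expr1n real_normK ?num_real//.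
  apply: le_trans dx; rewrite (bigD1 j)//= lerDl.
  by apply: sumr_ge0 => l _; exact: sqr_ge0.
have -> : @disc R q = sq @^-1` [set r | r <= 1] by [].
apply: closed_comp; last exact: closed_le.
by move=> x _; exact: sum_sqr_continuous.
Qed.

(** It makes a map that is continuous within the disc continuous on the whole space. Outside the
    disc this is the inversion [x / |x|^2], Euclidean norm understood, whose norm is at most 1
    there; no square root is involved. *)
Definition disc_retract (x : V) : V := (Num.max 1 (sq x))^-1 *: x.

Lemma disc_retract_disc x : disc (disc_retract x).
Proof.
rewrite /disc /=; under eq_bigr do rewrite mxE exprMn; rewrite -mulr_sumr -/(sq x).
set k := Num.max 1 _.
have k1 : 1 <= k by rewrite le_max lexx.
have kx : sq x <= k by rewrite le_max lexx orbT.
have k0 : 0 < k by apply: lt_le_trans k1.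
rewrite exprVn mulrC ler_pdivrMr ?exprn_gt0// mul1r.
by apply: le_trans kx _; rewrite expr2 ler_peMl// ltW.
Qed.

Lemma disc_retract_id x : disc x -> disc_retract x = x.
Proof. by move=> dx; rewrite /disc_retract max_l// invr1 scale1r. Qed.

Lemma disc_retract_continuous : continuous disc_retract.
Proof.
move=> x; have k0 : Num.max 1 (sq x) != 0 by rewrite gt_eqF// lt_max ltr01.
have c1 : {for x, continuous (cst (1 : R) : V -> R)} by exact: cst_continuous.
have cs : {for x, continuous sq} by exact: sum_sqr_continuous.
have c2 := continuous_max c1 cs.
have c3 : {for x, continuous (fun y : V => y)} by move=> A; exact.
exact: (cvgZ (cvgV k0 c2) c3).
Qed.

Lemma within_disc_retract (X : topologicalType) (a : V -> X) :
  {within @disc R q, continuous a} -> continuous (a \o disc_retract).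
Proof.
move=> /subspace_continuousP ca x A hA.
have h : \forall y \near disc_retract x, disc y -> A (a y).
  exact: (ca _ (disc_retract_disc x) A hA).
have h' : \forall y \near x, disc (disc_retract y) -> A (a (disc_retract y)).
  exact: (@disc_retract_continuous x _ h).
by apply: filterS h' => y; apply; exact: disc_retract_disc.
Qed.

Lemma base_point_sphere : (1 <= q)%N -> @sphere R q (base_point q).
Proof.
case: q => // q' _; rewrite /sphere /= big_ord_recl big1 => [|i _].
  by rewrite !mxE /= expr1n addr0.
by rewrite !mxE /= expr0n.
Qed.

Lemma sphere_disc : @sphere R q `<=` @disc R q.
Proof. by move=> x; rewrite /sphere /disc /= => ->. Qed.
End DiscRetraction.

(** * A representative of the boundary class inside one dual leaf *)

Theorem theorem1 (R : realType) (n m : nat)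
    (M : riemannianManifold R n) (B : riemannianManifold R m) (p : M -> B)
    (M_connected : connected [set: M])
    (M_complete : complete_manifold M)
    (M_nonneg : nonneg_sectional_curvature M)
    (B_connected : connected [set: B])
    (p_submersion : riemannian_submersion p)
    (p_not_twisted : ~ twisted p)
    (b0 : B) (x0 : M) (x0_fiber : p x0 = b0)
    (q : nat) (q_ge1 : (1 <= q)%N)
    (alpha : set ('rV[R]_q -> B)) (alpha_class : homotopy_group b0 alpha) :
  exists f : 'rV[R]_q -> M,
    boundary p x0 alpha f /\
    ~ set_surj (@sphere R q) (p @^-1` [set b0]) f.
Proof.
case: alpha_class => a [ac aS ae] <-.
pose rho := @disc_retract R q.
pose e : 'rV[R]_q := base_point q.
have eS : sphere e by exact: base_point_sphere.
have eD := sphere_disc eS.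
have arc : continuous (a \o rho) by exact: within_disc_retract.
(* For [y] in the disc and [t] between 0 and 1 the segment from [e] to [y] remains in the disc,
   where [rho] is the identity; for the other values [rho] keeps [H] defined and continuous. *)
pose H (yt : 'rV[R]_q * R) : B := a (rho (e + yt.2 *: (yt.1 - e))).
have Hc : continuous H.
  move=> yt; apply: (@continuous_comp _ _ _
    (fun yt : 'rV[R]_q * R => e + yt.2 *: (yt.1 - e)) (a \o rho)); last exact: arc.
  apply: cvgD; first exact: cvg_cst.
  apply: cvgZ; first by case: yt => y t; exact: cvg_snd.
  by apply: cvgB; [case: yt => y t; exact: cvg_fst|exact: cvg_cst].
have H0 s : H (rho s, 0) = p x0.
  by rewrite /H /= scale0r addr0 /rho disc_retract_id// ae x0_fiber.
have [h [hc hp hl he]] := path_lifting p_submersion M_complete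
  (@disc_retract_continuous R q) (@disc_retract_disc R q) (@disc_compact R q) Hc H0.
have ph x : p (h x) = a (rho x).
  rewrite hp /H /= scale1r addrC subrK /rho.
  by rewrite (disc_retract_id (disc_retract_disc x)).
have phD x : disc x -> p (h x) = a x by move=> xD; rewrite ph /rho disc_retract_id.
have hFS x : sphere x -> p (h x) = p x0.
  by move=> xS; rewrite (phD _ (sphere_disc xS)) x0_fiber; exact: aS.
(* The path that ends at [e] is constant, and constant paths stay at [x0] throughout the lifting. *)
have hex : h e = x0.
  apply: he => t; rewrite /H /rho /= (disc_retract_id eD) subrr scaler0 addr0.
  by rewrite disc_retract_id// ae x0_fiber.
exists h; split.
- exists h; split.
  + by split=> //; exact: continuous_subspaceT.
  (* On the disc [p \o h] equals [a], so a homotopy constant in time suffices; the same holds below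
     for [h] and itself. *)
  + exists (fun tx => a (rho tx.2)); split.
    * apply: continuous_subspaceT => tx.
      apply: (@continuous_comp _ _ _ (fun tx : R * 'rV[R]_q => tx.2) (a \o rho)).
        by case: tx => t x; exact: cvg_snd.
      exact: arc.
    * by move=> x xD; rewrite /rho disc_retract_id.
    * by move=> x xD; rewrite /= ph.
    * move=> t _; split=> /=.
      - exact: continuous_subspaceT.
      - by move=> x xS; rewrite /rho disc_retract_id; [exact: aS|exact: sphere_disc].
      - by rewrite /rho disc_retract_id.
  + exists (fun tx => h tx.2); split=> //.
    * apply: continuous_subspaceT => tx.
      apply: (@continuous_comp _ _ _ (fun tx : R * 'rV[R]_q => tx.2) h).
        by case: tx => t x; exact: cvg_snd.
      exact: hc.
    * by move=> t _; split=> //; exact: continuous_subspaceT.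
- move=> surj; apply: p_not_twisted => x; apply/seteqP; split=> // y _.
  have leaf_fiber z : p z = b0 -> dual_leaf p x0 z.
    by move=> /surj[s _ <-]; exact: hl.
  have [x' xx' /leaf_fiber x0x'] :=
    dual_leaf_meets_fiber p_submersion M_complete b0 x B_connected.
  have [y' yy' /leaf_fiber x0y'] :=
    dual_leaf_meets_fiber p_submersion M_complete b0 y B_connected.
  apply: dual_leaf_trans xx' _; apply: dual_leaf_trans (dual_leaf_sym x0x') _.
  by apply: dual_leaf_trans x0y' _; exact: dual_leaf_sym.
Qed.
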